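(* Let $a$ and $c$ be integers $\ge 2$. Then the hook+column part of the iterated plethysm $s_c\circ s_2\circ s_a$ is $$\left.\left(s_c\circ s_2\circ s_a\right)\right|_{\mathrm{h+c}}=\sum_{k=0}^{2c-1}\min\left\{\frac{k^2+k+2}{2},\frac{(2c-1-k)^2+(2c-1-k)+2}{2}\right\} s_{(2ac-2k,\,2^k)}+\sum_{k=1}^{2c-3}\min\left\{\left\lfloor\frac{(k+1)^2}{4}\right\rfloor,\left\lfloor\frac{(2c-1-k)^2}{4}\right\rfloor\right\} s_{(2ac-2k-1,\,2^k,\,1)}.$$
   Context: Let $\Lambda=\mathbb{Q}[p_1,p_2,\dots]$ be the algebra of symmetric functions, with power sums $p_k$ and Schur functions $s_\lambda$; for a positive integer $n$, $s_n=s_{(n)}$. The plethysm $\circ:\Lambda\times\Lambda\to\Lambda$ is the operation determined by: $p_n\circ p_m=p_{nm}$; for each $f\in\Lambda$ the map $g\mapsto g\circ f$ is an algebra homomorphism; and $p_n\circ f=f\circ p_n$ for all $f$ and $n$ (so $p_n\circ f$ is obtained from $f$ by replacing each $p_m$ by $p_{nm}$). Plethysm is associative, so iterated plethysms need no parentheses. A partition is a hook+column partition if it is of the form $(\alpha,2^\beta,1^\gamma)$ (first part $\alpha$, followed by $\beta$ parts equal to $2$ and $\gamma$ parts equal to $1$). Here $\alpha$ is always the first part, and it may be equal to $1$ or $2$ (so for example $(1^5)=(1,2^0,1^4)$ and $(2^2,1)=(2,2^1,1^1)$). For $f=\sum_\lambda a_\lambda s_\lambda$, the hook+column part is $\left.(f)\right|_{\mathrm{h+c}}=\sum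 a_\lambda s_\lambda$, the sum being over the hook+column partitions $\lambda$ only. *)

(* Defs.v *)
From Stdlib Require Import ClassicalEpsilon.
From HB Require Import structures.
From mathcomp Require Import all_boot all_order all_algebra finmap.
From mathcomp.multinomials Require Import monalg.

Set Implicit Arguments.
Unset Strict Implicit.
Unset Printing Implicit Defensive.

Import GRing.Theory.
Local Open Scope ring_scope.

(* The free commutative Q-algebra on countably many generators; the generator
   of index i : nat is the power sum p_(i+1). *)
Notation Lam := {malg rat[{cmonom nat}]}.

(* Only meaningful for k >= 1.  Locked, as is psubst, because unification
   otherwise tries to evaluate supports and does not return. *)
HB.lock Definition psum (k : nat) : Lam := mkmalgU (@ucm nat k.-1) 1.

Definition mon_eval (v : nat -> Lam) (m : {cmonom nat}) : Lam :=
  \prod_(i <- finsupp m) v i.+1 ^+ m i.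

Lemma mon_evalEw (v : nat -> Lam) (m : {cmonom nat}) (d : {fset nat}) :
  (finsupp m `<=` d)%fset ->
  mon_eval v m = \prod_(i <- d) v i.+1 ^+ m i.
Proof.
move=> le_md; rewrite /mon_eval (big_fset_incl _ le_md) // => i _.
by rewrite memNfinsupp => /eqP ->; rewrite expr0.
Qed.

Lemma mon_eval_mmorphism v : mmorphism (mon_eval v).
Proof.
split=> [m1 m2|]; last by rewrite /mon_eval mdom1 big_seq_fset0.
rewrite [in LHS]/mon_eval mdomD (mon_evalEw v (fsubsetUl _ (finsupp m2))).
rewrite (mon_evalEw v (fsubsetUr (finsupp m1) _)) -big_split /=.
by apply: eq_bigr => i _; rewrite cmM exprD.
Qed.

HB.instance Definition _ v :=
  isMultiplicative.Build {cmonom nat} Lam (mon_eval v) (mon_eval_mmorphism v).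

(* The Q-algebra endomorphism of Lam with p_k |-> v k for all k >= 1. *)
HB.lock Definition psubst (v : nat -> Lam) (f : Lam) : Lam :=
  mmap (@malgC {cmonom nat} rat) (mon_eval v) f.

(* p_n o f *)
Definition adams (n : nat) (f : Lam) : Lam := psubst (fun m => psum (n * m)) f.

(* plethysm g f is g o f *)
Definition plethysm (g f : Lam) : Lam := psubst (fun n => adams n f) g.

Lemma psubst_psum v k : (0 < k)%N -> psubst v (psum k) = v k.
Proof.
move=> k0; rewrite psubst.unlock psum.unlock mmapU /= mpolyC1E mul1r.
by rewrite /mon_eval mdomU big_seq_fset1 cmUU expr1 prednK.
Qed.

Lemma psubst1 v : psubst v 1 = 1.
Proof. rewrite psubst.unlock; exact: mmap1. Qed.

Lemma psubstD v : {morph psubst v : f g / f + g}.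
Proof. rewrite psubst.unlock; exact: mmapD. Qed.

Lemma psubstM v : {morph psubst v : f g / f * g}.
Proof.
rewrite psubst.unlock.
exact: (rmorphM (mmap (@malgC {cmonom nat} rat) (mon_eval v))).
Qed.

Lemma psubstZ v (a : rat) f : psubst v (a *: f) = a *: psubst v f.
Proof. by rewrite psubst.unlock mmapZ mul_malgC. Qed.

Lemma eq_psubst v w f : (forall k, (0 < k)%N -> v k = w k) ->
  psubst v f = psubst w f.
Proof.
move=> eq_vw; have E m : mon_eval v m = mon_eval w m.
  by rewrite /mon_eval; apply: eq_bigr => i _; rewrite eq_vw.
by rewrite psubst.unlock /mmap; apply: eq_bigr => m _; rewrite E.
Qed.

Lemma plethysm_psum n m : (0 < n)%N -> (0 < m)%N ->
  plethysm (psum n) (psum m) = psum (n * m).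
Proof.
by move=> n0 m0; rewrite /plethysm psubst_psum // /adams psubst_psum.
Qed.

Lemma plethysmD f : {morph plethysm^~ f : g h / g + h}.
Proof. exact: psubstD. Qed.

Lemma plethysmM f : {morph plethysm^~ f : g h / g * h}.
Proof. exact: psubstM. Qed.

Lemma plethysmZ f (a : rat) g : plethysm (a *: g) f = a *: plethysm g f.
Proof. exact: psubstZ. Qed.

Lemma plethysm1 f : plethysm 1 f = 1.
Proof. exact: psubst1. Qed.

Lemma plethysm_psumC n f : (0 < n)%N ->
  plethysm (psum n) f = plethysm f (psum n).
Proof.
move=> n0; rewrite /plethysm (psubst_psum _ n0) {1}/adams.
by apply: eq_psubst => k k0; rewrite /adams (psubst_psum _ n0) mulnC.
Qed.

(* h_n = \sum_(mu |- n) p_mu / z_mu, where m i is the multiplicity of i + 1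
   in mu, so that z_mu = \prod_i (i + 1)^(m i) (m i)!. *)
Definition hsym (n : nat) : Lam :=
  \sum_(m : {ffun 'I_n -> 'I_n.+1} | (\sum_(i < n) i.+1 * m i == n)%N)
    \prod_(i < n) (((i.+1 ^ m i * (m i)`!)%N%:R : rat)^-1 *: psum i.+1 ^+ m i).

(* s_la by the Jacobi-Trudi determinant det (h_(la_i - i + j)), with h_r = 0
   for r < 0; the case split is needed because subtraction on nat truncates. *)
Definition schur (la : seq nat) : Lam :=
  \det (\matrix_(i < size la, j < size la)
     if (i <= nth 0 la i + j)%N then hsym (nth 0 la i + j - i)%N else 0).

Lemma schur_row n : schur [:: n] = hsym n.
Proof. by rewrite /schur det_mx11 mxE /= addn0 subn0. Qed.

Definition is_part (la : seq nat) : bool := sorted geq la && (0%N \notin la).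

Definition intpart := {la : seq nat | is_part la}.

(* For a partition, the first part is left arbitrary and the remaining parts
   are 2^beta, 1^gamma. *)
Definition hook_column (la : seq nat) : bool :=
  if la is _ :: t then t == nseq (count_mem 2 t) 2 ++ nseq (count_mem 1 t) 1
  else false.

Lemma hook_columnP la :
  reflect (exists alpha beta gamma, la = alpha :: nseq beta 2 ++ nseq gamma 1)
          (hook_column la).
Proof.
case: la => [|x t] /=; first by constructor; case=> ? [? [? ]].
apply: (iffP eqP) => [{1}->|[alpha [b [g [_ ->]]]]].
  by exists x, (count_mem 2 t), (count_mem 1 t).
by rewrite !count_cat !count_nseq /= !mul1n !mul0n addn0.
Qed.

Definition schur_comb (a : {fsfun intpart -> rat with 0}) : Lam :=
  \sum_(la <- finsupp a) a la *: schur (val la).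

(* The coefficients of f in the Schur basis: the (unique) finitely supported
   family a with schur_comb a = f. *)
Definition schur_coef (f : Lam) : {fsfun intpart -> rat with 0} :=
  epsilon (inhabits [fsfun]) (fun a => schur_comb a = f).

Definition hc_part (f : Lam) : Lam :=
  \sum_(la <- finsupp (schur_coef f) | hook_column (val la))
     schur_coef f la *: schur (val la).

(* Main.v *)
From Stdlib Require Import ClassicalEpsilon.
Require Import Defs.
From HB Require Import structures.
From mathcomp Require Import all_boot all_order all_algebra fingroup perm finmap.
From mathcomp.multinomials Require Import monalg.
From mathcomp Require Import zify ring.

Set Implicit Arguments.
Unset Strict Implicit.
Unset Printing Implicit Defensive.

Import GRing.Theory.
Local Open Scope ring_scope.

(** The proof compares both sides in one variable x and two sign-changed
variables y, z. Let [ev (signed_psum x y z)] be the algebra homomorphism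
p_k |-> x^k - y^k - z^k. By the Jacobi-Trudi formula it kills s_la when the
second part of la is at least 3, while
  s_(al, 2^k, 1^g) |-> x^(al-2) (x - y) (x - z) (y z)^k (-1)^g h_g(y, z)
for al >= 2 ([jt_hsuper_cons], [jt_hodd_two_ones]). With x = X^(M^2), y = X^M,
z = X and M large, the images of the hook+column Schur functions are
polynomials of distinct degrees, so the image of f determines the hook+column
coefficients of f ([hc_part_eq]). Because hc_part is read off from some Schur
expansion of f, this also needs that every f has one ([schur_coefK]): products
of complete symmetric functions are reached from the Jacobi-Trudi formula by a
triangularity argument, and they span by Newton's identities.

The homomorphism turns p_n o f into the image of f at (x^n, y^n, z^n), so
plethysm becomes substitution of alphabets ([ev_plethysm]), where an alphabet is
a signed sum of monomials. Here h_a |-> x^(a-2) (x - y) (x - z), and h_2 o h_a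
has the alphabet x^(2a-4) (x^2 + y z) (x - y) (x - z), made of eight signed
monomials ([ev_h2h]). Put x = 1, e = y + z and q = y z to lighten the formulas.
Adding a monomial w to an alphabet divides the generating function of its
complete symmetric functions by 1 - w t, and removing w multiplies it, so
  sum_c t^c (h_c o h_2 o h_a)
    |-> (1 - t e + t^2 q) (1 - t q e + t^2 q^3) / D,
  D = (1 - t) (1 - t q)^2 (1 - t q^2).
The key identity is that this quotient equals
  1 + (1 - e + q) ((1 + q) t (1 - t q + t^2 q^2) - e q t^2) / D
([complete_h2h]). The factor 1 - e + q = (1 - y) (1 - z) is common to all
hook+column Schur functions that occur. The term linear in e gives those with
one part equal to 1: their multiplicities are the coefficients of
h_(c-2)(1, q, q, q^2) ([bpoly_rec]). The term free of e gives those without,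
with multiplicities the coefficients of
(1 + q) (h_(c-1) - q h_(c-2) + q^2 h_(c-3))(1, q, q, q^2) ([apolyE]). *)

(** * Evaluation of symmetric functions at given power sums *)

Section Evaluation.
Variable R : comAlgType rat.
Implicit Types (P : nat -> R) (f g : Lam).

Definition mon_val P (m : {cmonom nat}) : R :=
  \prod_(i <- finsupp m) P i.+1 ^+ m i.

Lemma mon_valEw P (m : {cmonom nat}) (d : {fset nat}) :
  (finsupp m `<=` d)%fset -> mon_val P m = \prod_(i <- d) P i.+1 ^+ m i.
Proof.
move=> le_md; rewrite /mon_val (big_fset_incl _ le_md) // => i _.
by rewrite memNfinsupp => /eqP ->; rewrite expr0.
Qed.

Lemma mon_val_mmorphism P : mmorphism (mon_val P).
Proof.
split=> [m1 m2|]; last by rewrite /mon_val mdom1 big_seq_fset0.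
rewrite [in LHS]/mon_val mdomD (mon_valEw P (fsubsetUl _ (finsupp m2))).
rewrite (mon_valEw P (fsubsetUr (finsupp m1) _)) -big_split /=.
by apply: eq_bigr => i _; rewrite cmM exprD.
Qed.

HB.instance Definition _ P :=
  isMultiplicative.Build {cmonom nat} R (mon_val P) (mon_val_mmorphism P).

End Evaluation.

(** Locked, since unification would otherwise unfold elements of Lam. *)
HB.lock Definition ev (R : comAlgType rat) (P : nat -> R) f : R :=
  mmap (in_alg R) (mon_val P) f.

Section EvaluationTheory.
Variable R : comAlgType rat.
Implicit Types (P : nat -> R) (f g : Lam).

Lemma ev_is_additive P : additive (ev P).
Proof. rewrite ev.unlock; exact: raddfB. Qed.

HB.instance Definition _ P :=
  GRing.isAdditive.Build Lam R (ev P) (ev_is_additive P).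

Lemma ev_is_multiplicative P : multiplicative (ev P).
Proof.
by split; rewrite ev.unlock; [move=> f g; exact: rmorphM | exact: rmorph1].
Qed.

HB.instance Definition _ P :=
  GRing.isMultiplicative.Build Lam R (ev P) (ev_is_multiplicative P).

Lemma evZ P a f : ev P (a *: f) = a *: ev P f.
Proof. by rewrite ev.unlock mmapZ mulr_algl. Qed.

Lemma ev_psum P k : (0 < k)%N -> ev P (psum k) = P k.
Proof.
move=> k0; rewrite ev.unlock psum.unlock mmapU /= scale1r mul1r.
by rewrite /= /mon_val mdomU big_seq_fset1 cmUU expr1 prednK.
Qed.

Lemma evE P f : ev P f = \sum_(m <- msupp f) f@_m *: mon_val P m.
Proof. by rewrite ev.unlock mmapE; apply: eq_bigr => m _; rewrite mulr_algl. Qed.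

Lemma eq_ev P Q f : (forall k, (0 < k)%N -> P k = Q k) -> ev P f = ev Q f.
Proof.
move=> eqPQ; rewrite !evE; apply: eq_bigr => m _; congr (_ *: _).
rewrite /mon_val; apply: eq_bigr => i _; by rewrite eqPQ.
Qed.

Lemma ev_psubst P v f : ev P (psubst v f) = ev (fun k => ev P (v k)) f.
Proof.
rewrite psubst.unlock [mmap _ _ _]mmapE rmorph_sum [RHS]evE.
apply: eq_bigr => m _; rewrite mul_malgC /= evZ; congr (_ *: _).
rewrite /= /mon_eval rmorph_prod; apply: eq_bigr => i _; by rewrite rmorphXn.
Qed.
End EvaluationTheory.

(** Plethysm is substitution of alphabets: the n-th power sum of the new
alphabet is the value of f at the power sums of index n k. *)
Lemma ev_plethysm (R : comAlgType rat) (P : nat -> R) g f :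
  ev P (plethysm g f) = ev (fun n => ev (fun k => P (n * k)%N) f) g.
Proof.
rewrite /plethysm ev_psubst; apply: eq_ev => n n0; rewrite /adams ev_psubst.
by apply: eq_ev => k k0; rewrite ev_psum // muln_gt0 n0.
Qed.

(** * Newton's identities *)

Definition eqmodX (R : comNzRingType) n (f g : {poly R}) :=
  exists r, f = g + 'X^n * r.

Section EqModX.
Variables (R : comNzRingType) (n : nat).
Implicit Types f g : {poly R}.

Lemma eqmodX_refl f : eqmodX n f f.
Proof. by exists 0; rewrite mulr0 addr0. Qed.

Lemma eqmodX_sym f g : eqmodX n f g -> eqmodX n g f.
Proof. by move=> [r ->]; exists (- r); rewrite mulrN addrK. Qed.

Lemma eqmodXM f1 g1 f2 g2 :
  eqmodX n f1 g1 -> eqmodX n f2 g2 -> eqmodX n (f1 * f2) (g1 * g2).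
Proof.
move=> [r1 ->] [r2 ->]; exists (r1 * g2 + g1 * r2 + 'X^n * r1 * r2).
ring.
Qed.

Lemma eqmodX_prod (I : Type) (s : seq I) (Q : pred I) (F G : I -> {poly R}) :
  (forall i, Q i -> eqmodX n (F i) (G i)) ->
  eqmodX n (\prod_(i <- s | Q i) F i) (\prod_(i <- s | Q i) G i).
Proof.
move=> FG; elim/big_rec2: _ => [|i f g Qi IH]; first exact: eqmodX_refl.
by apply: eqmodXM => //; exact: FG.
Qed.

Lemma eqmodX_coef f g i : eqmodX n f g -> (i < n)%N -> f`_i = g`_i.
Proof. by move=> [r ->] lt_in; rewrite coefD coefXnM lt_in addr0. Qed.
End EqModX.

(** The truncation of exp (p t^(i+1) / (i+1)) after the power L of its argument.
The product over i < n of these, with p the power sum of index i + 1, has h_n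
as coefficient of t^n, for n at most L. *)
Definition pexp (R : comAlgType rat) (p : R) (i L : nat) : {poly R} :=
  \sum_(j < L.+1) (((i.+1 ^ j * j`!)%N%:R : rat)^-1 *: p ^+ j) *:
     'X^(i.+1 * j).

Definition xderiv (R : comNzRingType) (f : {poly R}) := 'X * f^`().

Lemma xderiv_coef (R : comNzRingType) (f : {poly R}) n :
  (xderiv f)`_n = n%:R * f`_n.
Proof.
by rewrite /xderiv coefXM coef_deriv; case: n => [|n] /=; rewrite ?mul0r // mulr_natl.
Qed.

Section TruncatedExponential.
Variables (R : comAlgType rat) (p : R).

Lemma pexpS i L : pexp p i L.+1 = pexp p i L +
  (((i.+1 ^ L.+1 * L.+1`!)%N%:R : rat)^-1 *: p ^+ L.+1) *: 'X^(i.+1 * L.+1).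
Proof. by rewrite /pexp big_ord_recr. Qed.

Lemma pexp0 i : pexp p i 0 = 1.
Proof.
by rewrite /pexp big_ord_recr big_ord0 /= muln0 !expr0 invr1 !scale1r add0r.
Qed.

Lemma pexp_stable d i L k : (d <= i.+1 * L.+1)%N ->
  eqmodX d (pexp p i (L + k)) (pexp p i L).
Proof.
move=> le_d; elim: k => [|k [r IH]]; first by rewrite addn0; apply: eqmodX_refl.
rewrite addnS pexpS IH; set c := (X in X *: _).
exists (r + c *: 'X^(i.+1 * (L + k).+1 - d)).
rewrite mulrDr -addrA -scalerAr -exprD subnKC //.
by rewrite (leq_trans le_d) // leq_mul2l ltnS leq_addr orbT.
Qed.

(** Euler's derivation t d/dt multiplies exp (p t^(i+1) / (i+1)) by p t^(i+1);
with truncated exponentials the identity is exact if the order drops by one. *)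
Lemma xderiv_pexp i L : xderiv (pexp p i L.+1) = (p *: 'X^(i.+1)) * pexp p i L.
Proof.
apply/polyP => n; rewrite xderiv_coef /pexp big_ord_recl mulr_sumr.
rewrite coefD mulrDr !coef_sum mulr_sumr.
rewrite muln0 coefZ coefXn.
have -> : n%:R * (((i.+1 ^ 0 * 0`!)%:R : rat)^-1 *: p ^+ 0 * (n == 0%N)%:R) = 0 :> R.
  by case: n => [|n]; rewrite ?mul0r ?mulr0.
rewrite add0r; apply: eq_bigr => j _.
rewrite -scalerAl -scalerAr !coefZ -exprD lift0 -mulnS coefXn.
case: eqP => [->|_]; last by rewrite !mulr0.
rewrite !mulr1 -[RHS]scalerAr -exprS mulr_natl -scaler_nat scalerA.
congr (_ *: _); rewrite expnS factS !natrM.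
have h1 : (i.+1%:R : rat) != 0 by rewrite Num.Theory.pnatr_eq0.
have h2 : (j.+1%:R : rat) != 0 by rewrite Num.Theory.pnatr_eq0.
have h3 : ((i.+1 ^ j)%:R : rat) != 0 by rewrite Num.Theory.pnatr_eq0 expn_eq0.
have h4 : ((j`!)%:R : rat) != 0 by rewrite Num.Theory.pnatr_eq0 -lt0n fact_gt0.
move: (i.+1%:R : rat) (j.+1%:R : rat) ((i.+1 ^ j)%:R : rat) (j`!%:R : rat) h1 h2 h3 h4.
by move=> x1 x2 x3 x4 h1 h2 h3 h4; field; rewrite h1 h2 h3 h4.
Qed.
End TruncatedExponential.

Lemma xderiv_prod (R : comNzRingType) d N (p : nat -> {poly R}) (E : nat -> {poly R}) :
  (forall i, eqmodX d (xderiv (E i)) (p i * E i)) ->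
  eqmodX d (xderiv (\prod_(i < N) E i)) ((\sum_(i < N) p i) * \prod_(i < N) E i).
Proof.
move=> pE; elim: N => [|N [r IH]].
  by rewrite !big_ord0 mul0r /xderiv -[1]/(1%:P) derivC mulr0; apply: eqmodX_refl.
have [r' E'] := pE N; rewrite !big_ord_recr /=.
exists (r * E N + (\prod_(i < N) E i) * r').
have -> f g : xderiv (f * g) = xderiv f * g + f * xderiv g.
  by rewrite /xderiv derivM; ring.
by rewrite IH E'; ring.
Qed.

Lemma hsymE n : hsym n = (\prod_(i < n) pexp (psum i.+1) i n)`_n.
Proof.
rewrite /pexp bigA_distr_bigA /= coef_sum /hsym [LHS]big_mkcond /=.
apply: eq_bigr => m _.
have -> : \prod_(i < n) ((((i.+1 ^ m i * (m i)`!)%N%:R : rat)^-1 *: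
      psum i.+1 ^+ m i) *: 'X^(i.+1 * m i)) =
    (\prod_(i < n) (((i.+1 ^ m i * (m i)`!)%N%:R : rat)^-1 *:
      psum i.+1 ^+ m i)) *: ('X^(\sum_(i < n) i.+1 * m i) : {poly Lam}).
  by rewrite -prodrXr scaler_prod.
by rewrite coefZ coefXn eq_sym; case: eqP => _; rewrite ?mulr1 ?mulr0.
Qed.

(** Neither factors of index i >= n nor higher truncation orders affect the
coefficient of t^n. *)
Lemma hsym_stable n L : (n <= L)%N -> hsym n = (\prod_(i < L) pexp (psum i.+1) i L)`_n.
Proof.
move=> le_nL; rewrite hsymE -!(big_mkord xpredT (fun i => pexp (psum i.+1) i _)).
rewrite [in RHS](big_cat_nat (n := n)) //=; apply/esym.
apply: (@eqmodX_coef _ n.+1) => //; rewrite -[X in eqmodX _ _ X]mulr1.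
apply: eqmodXM.
  apply: eqmodX_prod => i _; rewrite -(subnKC le_nL); apply: pexp_stable.
  by rewrite mulSn leq_addr.
rewrite big_seq -[X in eqmodX _ _ X]
  (@big1_eq _ _ *%R _ (index_iota n L) (mem (index_iota n L))).
apply: eqmodX_prod => i; rewrite mem_index_iota => /andP [le_ni _].
by rewrite -(pexp0 (psum i.+1) i) -[L]add0n; apply: pexp_stable; rewrite muln1 ltnS.
Qed.

(** The logarithmic derivative of the product of exponentials is the sum of
the p_(i+1) t^(i+1). *)
Lemma hsym_newton n :
  n%:R * hsym n = \sum_(i < n) psum i.+1 * hsym (n - i.+1).
Proof.
rewrite (hsym_stable (leqnSn n)) -xderiv_coef.
rewrite (@eqmodX_coef _ n.+1 _ _ _ (@xderiv_prod _ n.+1 n.+1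
  (fun i => psum i.+1 *: 'X^(i.+1)) (fun i => pexp (psum i.+1) i n.+1) _)) //;
  last first.
  move=> i; rewrite xderiv_pexp; apply: eqmodXM; first exact: eqmodX_refl.
  by rewrite -[n.+1 in X in eqmodX _ _ X]addn1; apply/eqmodX_sym/pexp_stable/leq_pmull.
rewrite mulr_suml coef_sum big_ord_recr /= -scalerAl coefZ coefXnM ltnSn mulr0 addr0.
apply: eq_bigr => i _; rewrite -scalerAl coefZ coefXnM ltnNge ltn_ord /=.
by rewrite -hsym_stable // leqW // leq_subr.
Qed.

(** * Complete symmetric functions of signed alphabets *)

Section CompleteValues.
Variable R : comAlgType rat.
Implicit Types (P : nat -> R) (u : nat -> R).

Definition complete P n := ev P (hsym n).

Lemma hsym0 : hsym 0 = 1.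
Proof. by rewrite hsymE big_ord0 coef1. Qed.

Lemma complete0 P : complete P 0 = 1.
Proof. by rewrite /complete hsym0 rmorph1. Qed.

Lemma complete_newton P n :
  n.+1%:R * complete P n.+1 = \sum_(i < n.+1) P i.+1 * complete P (n - i).
Proof.
rewrite /complete -[n.+1%:R](rmorph_nat (ev P)) -rmorphM /= hsym_newton rmorph_sum.
by apply: eq_bigr => i _; rewrite rmorphM /= ev_psum // subSS.
Qed.

Lemma mulSn_inj n : injective (fun a : R => n.+1%:R * a).
Proof.
move=> a b /(congr1 (GRing.scale (n.+1%:R)^-1)).
by rewrite !mulr_natl -!(scaler_nat n.+1) !scalerK // Num.Theory.pnatr_eq0.
Qed.

(** Newton's identities determine h_n from the power sums, as rat is contained
in R. *)
Lemma complete_unique P u : u 0%N = 1 ->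
  (forall n, n.+1%:R * u n.+1 = \sum_(i < n.+1) P i.+1 * u (n - i)%N) ->
  u =1 complete P.
Proof.
move=> u0 uS n; have [m] := ubnP n; elim: m n => // m IH [_|n ltnm].
  by rewrite u0 complete0.
apply: (@mulSn_inj n); rewrite /= uS complete_newton; apply: eq_bigr => i _.
by rewrite IH // (leq_ltn_trans (leq_subr _ _)).
Qed.

Lemma eq_complete P Q n : (forall k, (0 < k)%N -> P k = Q k) ->
  complete P n = complete Q n.
Proof. exact: eq_ev. Qed.

Lemma complete_zero n : complete (fun=> 0) n.+1 = 0.
Proof.
apply: (@mulSn_inj n); rewrite /= complete_newton mulr0 big1 // => i _.
by rewrite mul0r.
Qed.

(** Multiplication by t, on the coefficient sequence of a power series. *)
Definition shift u n := if n is m.+1 then u m else 0.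

(** Removing the letter w multiplies the generating function by 1 - w t: the
product satisfies Newton's identities for the new power sums. *)
Lemma complete_sub P w n :
  complete (fun k => P k - w ^+ k) n = complete P n - w * shift (complete P) n.
Proof.
pose v n := complete P n - w * shift (complete P) n; rewrite -/(v n); apply/esym.
apply: complete_unique => [|{}n]; first by rewrite /v /= complete0 mulr0 subr0.
(* v is (1 - w t) H(t), so w t / (1 - w t) times v is w t H(t) *)
have telesc : \sum_(i < n.+1) w ^+ i.+1 * v (n - i)%N = w * complete P n.
  elim: n => [|n IH].
    by rewrite big_ord_recr big_ord0 /v /= expr1 complete0 mulr0 subr0 add0r.
  rewrite big_ord_recl subn0 expr1.
  under eq_bigr do rewrite lift0 exprS subSS -mulrA.
  by rewrite -mulr_sumr IH /v /=; ring.
under eq_bigr do rewrite mulrBl.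
rewrite sumrB telesc {telesc}/v.
under eq_bigr do rewrite mulrBr mulrCA.
rewrite /= sumrB -mulr_sumr mulrBr complete_newton.
suff -> : \sum_(i < n.+1) P i.+1 * shift (complete P) (n - i) = n%:R * complete P n.
  by rewrite -natr1; ring.
rewrite big_ord_recr /= subnn mulr0 addr0.
case: n => [|n]; first by rewrite big_ord0 mul0r.
rewrite complete_newton; apply: eq_bigr => i _.
by rewrite subSn // -ltnS.
Qed.
End CompleteValues.

(** * Schur functions span *)

Definition schur_spanned (f : Lam) :=
  exists l : seq (rat * intpart), f = \sum_(p <- l) p.1 *: schur (val p.2).

Lemma schur_spanned0 : schur_spanned 0.
Proof. by exists [::]; rewrite big_nil. Qed.

Lemma schur_spannedD f g :
  schur_spanned f -> schur_spanned g -> schur_spanned (f + g).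
Proof. by move=> [l ->] [l' ->]; exists (l ++ l'); rewrite big_cat. Qed.

Lemma schur_spannedZ a f : schur_spanned f -> schur_spanned (a *: f).
Proof.
move=> [l ->]; exists [seq (a * p.1, p.2) | p <- l].
by rewrite big_map scaler_sumr; apply: eq_bigr => p _; rewrite scalerA.
Qed.

Lemma schur_spanned_sum (I : Type) (r : seq I) (P : pred I) (F : I -> Lam) :
  (forall i, P i -> schur_spanned (F i)) ->
  schur_spanned (\sum_(i <- r | P i) F i).
Proof.
move=> PF; elim/big_ind: _ => //; [exact: schur_spanned0|exact: schur_spannedD].
Qed.

Lemma schur_spanned_schur la : is_part la -> schur_spanned (schur la).
Proof.
by move=> pla; exists [:: (1, Sub la pla : intpart)]; rewrite big_seq1 scale1r SubK.
Qed.

Definition hprod (s : seq nat) : Lam := \prod_(i <- s) hsym i.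

Lemma perm_hprod s t : perm_eq s t -> hprod s = hprod t.
Proof. exact: perm_big. Qed.

Definition part_of (s : seq nat) := sort geq [seq i <- s | (0 < i)%N].

Lemma part_of_is_part s : is_part (part_of s).
Proof.
rewrite /is_part /part_of sort_sorted; last by move=> x y; apply: leq_total.
by rewrite mem_sort mem_filter.
Qed.

Lemma hprod_part_of s : hprod (part_of s) = hprod s.
Proof.
rewrite (perm_hprod (permEl (perm_sort _ _))) /hprod big_filter [in RHS](bigID (leq 1)) /=.
rewrite [X in _ * X]big1 ?mulr1 // => i; rewrite -eqn0Ngt => /eqP ->.
exact: hsym0.
Qed.

Lemma sumn_part_of s : sumn (part_of s) = sumn s.
Proof.
rewrite !sumnE (perm_big _ (permEl (perm_sort _ _))) big_filter [in RHS](bigID (leq 1)) /=.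
rewrite [X in (_ + X)%N]big1 ?addn0 // => i; rewrite -eqn0Ngt => /eqP ->.
by [].
Qed.

(** The function i |-> B^i - 1 vanishes at 0, so dropping zero parts does not
change the weight, and it grows so fast that one part outweighs any number
below B of smaller parts. *)
Definition expwt B (s : seq nat) := (\sum_(i <- s) (B ^ i).-1)%N.

Lemma expwt_part_of B s : expwt B (part_of s) = expwt B s.
Proof.
rewrite /expwt (perm_big _ (permEl (perm_sort _ _))) big_filter [in RHS](bigID (leq 1)) /=.
rewrite [X in (_ + X)%N]big1 ?addn0 // => i; rewrite -eqn0Ngt => /eqP ->.
by [].
Qed.

Lemma leq_expwt B s : (0 < B)%N -> (expwt B s <= sumn s * B ^ sumn s)%N.
Proof.
move=> B0; rewrite [X in (_ <= X * _)%N]sumnE big_distrl /= /expwt !big_seq.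
apply: leq_sum => i si; case: i si => [|i] si; first by rewrite expn0.
rewrite mulSn (leq_trans (leq_pred _)) // (leq_trans _ (leq_addr _ _)) //.
by rewrite leq_pexp2l // sumnE (big_rem _ si) leq_addr.
Qed.

Lemma size_part s : is_part s -> (size s <= sumn s)%N.
Proof.
move=> /andP [_]; elim: s => //= i s IH; rewrite inE negb_or eq_sym -lt0n.
by case/andP => i0 /IH le; rewrite -add1n leq_add.
Qed.

Definition jacobi_trudi (R : comNzRingType) (h : nat -> R) (la : seq nat) : R :=
  \det (\matrix_(i < size la, j < size la)
     if (i <= nth 0 la i + j)%N then h (nth 0 la i + j - i)%N else 0).

Lemma schurE la : schur la = jacobi_trudi hsym la.
Proof. by []. Qed.

Lemma jacobi_trudi_expand (R : comNzRingType) (h : nat -> R) s :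
  jacobi_trudi h s = \prod_(i <- s) h i + \sum_(sg : 'S_(size s) | sg != 1%g)
    (-1) ^+ sg * \prod_(i < size s)
      (if (i <= nth 0 s i + sg i)%N then h (nth 0 s i + sg i - i)%N else 0).
Proof.
rewrite /jacobi_trudi /determinant (bigD1 (1%g : 'S_(size s))) //=.
rewrite odd_perm1 expr0 mul1r; congr (_ + _).
  rewrite (big_nth 0%N) big_mkord; apply: eq_bigr => i _.
  by rewrite mxE perm1 leq_addl addnK.
by apply: eq_bigr => sg _; congr (_ * _); apply: eq_bigr => i _; rewrite mxE.
Qed.

Section JacobiTrudiTerm.
Variables (s : seq nat) (sg : 'S_(size s)).
Definition jt_index (i : 'I_(size s)) := (nth 0 s i + sg i - i)%N.
Hypothesis sg_ok : forall i : 'I_(size s), (i <= nth 0 s i + sg i)%N.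

Lemma sumn_jt_index : sumn (codom jt_index) = sumn s.
Proof.
have E : (\sum_i jt_index i + \sum_(i < size s) i =
          \sum_(i < size s) nth 0 s i + \sum_(i < size s) i)%N.
  rewrite [X in (_ + X)%N = _]big_mkcond /= -big_split /=.
  rewrite (eq_bigr (fun i : 'I__ => nth 0 s i + sg i)%N) => [|i _]; last exact: subnK.
  by rewrite big_split /=; congr addn; rewrite [in RHS](reindex_perm sg).
rewrite !sumnE [RHS](big_nth 0%N) big_mkord -(addIn E).
by rewrite codomE big_map big_enum.
Qed.

(** Let r be the first index moved by sg. The terms before r are those of s,
and the term of index r is at least s_r + 1, so it alone outweighs all the
remaining parts of s, which are at most s_r and fewer than B. *)
Lemma expwt_jt_index B : sorted geq s -> (size s < B)%N -> sg != 1%g ->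
  (expwt B s < expwt B (codom jt_index))%N.
Proof.
move=> s_sorted ltB sg1.
have B0 : (0 < B)%N by exact: leq_ltn_trans ltB.
have /existsP [i0 i0P] : [exists i, sg i != i].
  apply: contraR sg1 => /existsPn sgP.
  by apply/eqP/permP => i; rewrite perm1; apply/eqP/negPn; exact: sgP.
case: (@arg_minnP _ i0 (fun i => sg i != i)
  (fun i : 'I_(size s) => i : nat) i0P) => r rP r_min.
have sg_lt (i : 'I_(size s)) : (i < r)%N -> sg i = i.
  move=> ltir; apply/eqP/negPn/negP => /r_min; rewrite leqNgt ltir.
  by [].
have r_lt : (r < sg r)%N.
  rewrite ltn_neqAle eq_sym rP leqNgt; apply/negP => /sg_lt /perm_inj /eqP.
  by rewrite (negPf rP).
have wE t : (expwt B t + size t = \sum_(i <- t) B ^ i)%N.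
  rewrite /expwt -sum1_size -big_split /=; apply: eq_bigr => i _.
  by rewrite addn1 prednK // expn_gt0 B0.
rewrite -(ltn_add2r (size s)) wE.
rewrite -[X in (_ < _ + X)%N](_ : size (codom jt_index) = _); last first.
  by rewrite size_codom card_ord.
rewrite wE [X in (X < _)%N](big_nth 0%N) big_mkord codomE big_map big_enum /=.
rewrite (bigID (fun i : 'I_(size s) => i < r)%N)
  [X in (_ < X)%N](bigID (fun i : 'I_(size s) => i < r)%N) /=.
rewrite [X in (_ < X + _)%N](eq_bigr (fun i : 'I_(size s) => B ^ nth 0 s i)%N)
  => [|i ltir]; last first.
  by rewrite /jt_index (sg_lt i ltir) addnK.
rewrite ltn_add2l.
apply: (@leq_ltn_trans (\sum_(i < size s) B ^ nth 0 s r)%N).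
  rewrite big_mkcond; apply: leq_sum => i _; case: ltnP => //= le_ri.
  rewrite leq_pexp2l //.
  have := sorted_leq_nth (rev_trans leq_trans) leqnn 0%N s_sorted.
  by apply; rewrite ?inE.
rewrite sum_nat_const card_ord.
apply: (@leq_trans (B ^ (nth 0 s r).+1)).
  by rewrite expnS ltn_pmul2r // expn_gt0 B0.
rewrite (bigD1 r) /=; last by rewrite ltnn.
rewrite (leq_trans _ (leq_addr _ _)) // leq_pexp2l // /jt_index.
by rewrite ltn_subRL addnC ltn_add2l.
Qed.
End JacobiTrudiTerm.

(** The Jacobi-Trudi formula writes the product of the h_(s_i) as s_s plus
products of the same degree n and of larger weight; the weight is at most
n B^n. *)
Lemma schur_spanned_hprod s : schur_spanned (hprod s).
Proof.
rewrite -hprod_part_of; have := part_of_is_part s; move: (part_of s) => {}s.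
set n := sumn s; set B := n.+1.
have [k] := ubnP (n * B ^ n - expwt B s); have : sumn s = n by [].
move: n @B => n B; elim: k s => // k IH s sn; rewrite ltnS => le_k ps.
have -> : hprod s = schur s - \sum_(sg : 'S_(size s) | sg != 1%g)
    (-1) ^+ sg * \prod_(i < size s)
      (if (i <= nth 0 s i + sg i)%N then hsym (nth 0 s i + sg i - i)%N else 0).
  by rewrite schurE jacobi_trudi_expand addrK.
apply: schur_spannedD; first exact: schur_spanned_schur.
rewrite -scaleN1r; apply/schur_spannedZ/schur_spanned_sum => sg sg1.
rewrite mulr_sign -scaler_sign; apply: schur_spannedZ.
have [/forallP ok|] := boolP [forall i : 'I_(size s), (i <= nth 0 s i + sg i)%N]; last first.
  rewrite negb_forall => /existsP [i /negbTE i_bad].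
  by rewrite (bigD1 i) //= i_bad mul0r; apply: schur_spanned0.
rewrite [X in schur_spanned X](_ : _ = hprod (codom (jt_index sg))); last first.
  rewrite /hprod codomE big_map big_enum /=; apply: eq_bigr => i _.
  by rewrite ok.
rewrite -hprod_part_of; apply: IH; last exact: part_of_is_part.
  by rewrite sumn_part_of sumn_jt_index.
apply: leq_trans le_k; rewrite expwt_part_of ltn_sub2l //.
  apply: leq_trans (_ : expwt B (codom (jt_index sg)) <= _)%N.
    apply: expwt_jt_index => //; first by case/andP: ps.
    by rewrite ltnS -sn size_part.
  by apply: leq_trans (leq_expwt _ _) _; rewrite // sumn_jt_index // sn.
apply: expwt_jt_index => //; first by case/andP: ps.
by rewrite ltnS -sn size_part.
Qed.

Lemma malgUZ (K : choiceType) (R : ringType) (c : R) (k : K) :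
  << c *g k >> = c *: << k >> :> {malg R[K]}.
Proof. by apply/malgP => k'; rewrite mcoeffZ !mcoeffU mulrnAr mulr1. Qed.

Lemma malgUM (K : monomType) (R : ringType) (k l : K) :
  << mmul k l >> = << k >> * << l >> :> {malg R[K]}.
Proof. by rewrite malgM_def fgmulUU mulr1. Qed.

(** Monomials are the products of power sums, so the p_k generate Lam. *)
Lemma monomialE (m : {cmonom nat}) : << m >> = mon_eval psum m.
Proof.
have [d] := ubnP (mdeg m); elim: d m => [|d IH] m; first by rewrite ltn0.
have [m1 _|] := eqVneq (mdeg m) 0%N.
  by rewrite (mdeg_eq0I m1) mmorph1.
rewrite mdegE; have [->|[i im]] := fset_0Vmem (finsupp m).
  by rewrite big_seq_fset0.
move=> _ ltmd; have mE : m = mmul (ucm i) (divcm m (ucm i)).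
  apply/eqP/cmP => j; rewrite cmM divcmE subnKC // ucmE.
  by case: eqP => // <-; rewrite lt0n cmE_neq0.
rewrite mE malgUM mmorphM (IH (divcm m (ucm i))); last first.
  by move: ltmd; rewrite -mdegE {1}mE mdegM mdegU add1n ltnS.
congr (_ * _); rewrite /= /mon_eval mdomU big_seq_fset1 cmUU expr1.
by rewrite psum.unlock.
Qed.

Lemma Lam_ind (T : Lam -> Prop) :
  T 1 -> (forall k, T (psum k.+1)) ->
  (forall f g, T f -> T g -> T (f + g)) ->
  (forall f g, T f -> T g -> T (f * g)) ->
  (forall a f, T f -> T (a *: f)) -> forall f, T f.
Proof.
move=> T1 Tp TD TM TZ f.
have T0 : T 0 by rewrite -(scale0r 1); exact: TZ.
have Tm (m : {cmonom nat}) : T << m >>.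
  rewrite monomialE /mon_eval; refine (big_ind T T1 TM _) => i _.
  elim: (m i) => [|n IH]; first by rewrite expr0; exact: T1.
  rewrite exprS; exact: (TM _ _ (Tp i) IH).
refine (eq_ind_r T _ (monalgE f)).
refine (big_ind T T0 TD _) => k _.
by rewrite malgUZ; exact: (TZ _ _ (Tm k)).
Qed.

Definition hprod_spanned (f : Lam) :=
  exists l : seq (rat * seq nat), f = \sum_(p <- l) p.1 *: hprod p.2.

Lemma hprod_spannedD f g :
  hprod_spanned f -> hprod_spanned g -> hprod_spanned (f + g).
Proof. by move=> [l ->] [l' ->]; exists (l ++ l'); rewrite big_cat. Qed.

Lemma hprod_spannedZ a f : hprod_spanned f -> hprod_spanned (a *: f).
Proof.
move=> [l ->]; exists [seq (a * p.1, p.2) | p <- l].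
by rewrite big_map scaler_sumr; apply: eq_bigr => p _; rewrite scalerA.
Qed.

Lemma hprod_spannedM f g :
  hprod_spanned f -> hprod_spanned g -> hprod_spanned (f * g).
Proof.
move=> [l ->] [l' ->].
exists [seq (p.1 * q.1, p.2 ++ q.2) | p <- l, q <- l'].
rewrite big_allpairs_dep /= mulr_suml; apply: eq_bigr => p _.
rewrite mulr_sumr; apply: eq_bigr => q _.
by rewrite /hprod big_cat /= -scalerAl -scalerAr scalerA.
Qed.

Lemma hprod_spanned_hsym n : hprod_spanned (hsym n).
Proof. by exists [:: (1, [:: n])]; rewrite big_seq1 scale1r /hprod big_seq1. Qed.

(** Newton's identity of order n + 1, solved for p_(n+1). *)
Lemma hprod_spanned_psum n : hprod_spanned (psum n.+1).
Proof.
have [m] := ubnP n; elim: m n => // m IH n ltnm.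
have -> : psum n.+1 = n.+1%:R *: hsym n.+1 +
     \sum_(i < n) -1 *: (psum i.+1 * hsym (n - i)).
  rewrite scaler_nat -mulr_natl hsym_newton big_ord_recr /= subnn hsym0 mulr1.
  under [X in _ = _ + X]eq_bigr do rewrite scaleN1r.
  by rewrite sumrN [X in X - _]addrC addrK.
apply: hprod_spannedD; first exact/hprod_spannedZ/hprod_spanned_hsym.
elim/big_ind: _ => [||i _].
- by exists [::]; rewrite big_nil.
- exact: hprod_spannedD.
apply/hprod_spannedZ/hprod_spannedM; last exact: hprod_spanned_hsym.
by apply: IH; rewrite (leq_trans (ltn_ord i)).
Qed.

Lemma schur_spanning f : schur_spanned f.
Proof.
suff [l ->] : hprod_spanned f.
  apply: schur_spanned_sum => p _; exact/schur_spannedZ/schur_spanned_hprod.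
apply: Lam_ind f.
- by rewrite -hsym0; exact: hprod_spanned_hsym.
- exact: hprod_spanned_psum.
- exact: hprod_spannedD.
- exact: hprod_spannedM.
- exact: hprod_spannedZ.
Qed.

(** This is what gives access to schur_coef: by choice it is some Schur
expansion, as soon as there is one. *)
Lemma schur_coefK f : schur_comb (schur_coef f) = f.
Proof.
refine (@epsilon_spec _ _ (fun a => schur_comb a = f) _).
have [l ->] := schur_spanning f.
pose c la := \sum_(p <- l | p.2 == la) p.1.
pose d := [fset p.2 | p in l]%fset.
pose a : {fsfun intpart -> rat with 0} := [fsfun la in d => c la].
exists a.
have aE la : la \in d -> a la = c la by move=> lad; rewrite fsfun_fun lad.
have sub_ad : (finsupp a `<=` d)%fset by apply: finsupp_sub.
rewrite /schur_comb (big_fset_incl _ sub_ad) => [|la _]; last first.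
  by rewrite memNfinsupp => /eqP ->; rewrite scale0r.
transitivity (\sum_(la <- d) \sum_(p <- l) if la == p.2 then p.1 *: schur (val la) else 0).
  rewrite big_seq [RHS]big_seq; apply: eq_bigr => la lad.
  rewrite (aE la lad) /c scaler_suml big_mkcond; apply: eq_bigr => p _.
  by rewrite eq_sym.
rewrite exchange_big [LHS]big_seq [RHS]big_seq; apply: eq_bigr => p pl.
rewrite -big_mkcond.
apply: (@fbig_pred1_inj _ _ _ _ _ (fun la => p.1 *: schur (val la)) id) => //.
by apply/imfsetP; exists p.
Qed.

(** * Jacobi-Trudi determinants in one even and two odd variables *)

Lemma ev_schur (R : comAlgType rat) (P : nat -> R) la :
  ev P (schur la) = jacobi_trudi (complete P) la.
Proof.
rewrite schurE /jacobi_trudi -det_map_mx; congr (\det _).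
apply/matrixP => i j; rewrite !mxE /=.
by case: ifP => // _; rewrite rmorph0.
Qed.

Section FirstRow.
Variables (R : comNzRingType) (n : nat).
Implicit Types A B : 'M[R]_n.+1.

Lemma det_row0 A : (forall j, A 0 (lift 0 j) = 0) ->
  \det A = A 0 0 * \det (row' 0 (col' 0 A)).
Proof.
move=> A0; rewrite (expand_det_row A 0) big_ord_recl big1 => [|j _]; last first.
  by rewrite A0 mul0r.
by rewrite addr0 /cofactor expr0 mul1r.
Qed.

Lemma det_col0 A : (forall i, A (lift 0 i) 0 = 0) ->
  \det A = A 0 0 * \det (row' 0 (col' 0 A)).
Proof.
move=> A0; rewrite -det_tr det_row0 => [|j]; last by rewrite mxE A0.
rewrite mxE -[in RHS]det_tr; congr (_ * \det _).
by apply/matrixP => i j; rewrite !mxE.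
Qed.

Lemma det_row0_eq A B : row' 0 A = row' 0 B ->
  (forall j, A 0 (lift 0 j) = B 0 (lift 0 j)) ->
  \det A = \det B + (A 0 0 - B 0 0) * \det (row' 0 (col' 0 B)).
Proof.
move=> rAB AB; rewrite (expand_det_row A 0) (expand_det_row B 0).
have cAB j : cofactor A 0 j = cofactor B 0 j.
  rewrite /cofactor; congr (_ * \det _).
  by apply/matrixP => i k; have /matrixP/(_ i (lift j k)) := rAB; rewrite !mxE.
rewrite !big_ord_recl /=
  (eq_bigr (fun j => B 0 (lift 0 j) * cofactor B 0 (lift 0 j))) => [|j _];
  last first.
  by rewrite AB cAB.
by rewrite cAB /cofactor expr0 mul1r; ring.
Qed.
End FirstRow.

Section Specialized.
Variables (R : comNzRingType) (x e q : R).

(** For e = y + z and q = y z: the coefficients of (1 - y t) (1 - z t). *)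
Definition hodd n : R := match n with 0 => 1 | 1 => - e | 2 => q | _ => 0 end.

(** The coefficients of (1 - y t) (1 - z t) / (1 - x t). *)
Fixpoint hsuper n : R := if n is m.+1 then hodd n + x * hsuper m else 1.

Definition jtmx (h : nat -> R) la : 'M[R]_(size la) :=
  \matrix_(i < size la, j < size la)
     if (i <= nth 0 la i + j)%N then h (nth 0 la i + j - i)%N else 0.

Lemma jtmx_minor (h : nat -> R) al mu :
  row' 0 (col' 0 (jtmx h (al :: mu))) = jtmx h mu :> 'M_(size mu).
Proof.
apply/matrixP => i j; rewrite !mxE !lift0 /= addnS ltnS.
by rewrite subSS.
Qed.

Lemma jt_hodd_cons al mu : (2 <= al)%N ->
  jacobi_trudi hodd (al :: mu) = hodd al * jacobi_trudi hodd mu.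
Proof.
move=> al2; rewrite /jacobi_trudi -!/(jtmx _ _).
rewrite (@det_row0 _ (size mu) (jtmx hodd (al :: mu))) => [|j]; last first.
  by rewrite mxE /= addnS subn0; case: al al2 => [|[|al]].
by rewrite (jtmx_minor hodd al mu) mxE /= addn0 subn0.
Qed.

(** Right multiplication by this unitriangular matrix subtracts x times the
previous column from each column, turning hsuper into hodd in all columns
except the first. *)
Definition colop n : 'M[R]_n := \matrix_(i, j) ((i == j)%:R - x * (i.+1 == j)%:R).

Lemma det_colop n : \det (colop n) = 1.
Proof.
rewrite -det_tr det_trig.
  apply: big1 => i _; rewrite !mxE eqxx.
  by rewrite (gtn_eqF (ltnSn i)) mulr0 subr0.
apply/is_trig_mxP => i j ltij; rewrite !mxE.
by rewrite -val_eqE /= (gtn_eqF ltij) gtn_eqF ?mulr0 ?subr0 // ltnS ltnW.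
Qed.

Definition jtmx_op la : 'M[R]_(size la) :=
  \matrix_(i < size la, j < size la)
     if (i <= nth 0 la i + j)%N then
       (if j == 0 :> nat then hsuper else hodd) (nth 0 la i + j - i)%N else 0.

Lemma jt_hsuper_op la : jacobi_trudi hsuper la = \det (jtmx_op la).
Proof.
rewrite /jacobi_trudi -/(jtmx _ _) -[LHS]mulr1 -(det_colop (size la)) -det_mulmx.
congr (\det _); apply/matrixP => i j; rewrite !mxE.
set a := nth 0%N la i.
under eq_bigr do rewrite [colop _ _ _]mxE mulrBr.
rewrite sumrB (bigD1 j) //= eqxx mulr1 mxE big1 => [|k kj]; last first.
  by rewrite (negPf kj) mulr0.
rewrite addr0; case: j => -[|j] ltj /=.
  by rewrite big1 ?subr0 // => k _; rewrite mulr0 mulr0.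
rewrite (bigD1 (Ordinal (ltnW ltj))) //= eqxx mulr1 mxE big1 => [|k kj]; last first.
  suff -> : (k.+1 == j.+1) = false by rewrite !mulr0.
  by apply: contraNF kj => /eqP [kj]; apply/eqP/val_inj.
rewrite addr0 /= -/a addnS; case: ltngtP => [lt_i|gt_i|->].
- by rewrite subSn //= ifT //; ring.
- by rewrite ifF ?mul0r ?subr0 //; apply/negbTE; rewrite -ltnNge; exact: ltnW.
- by rewrite subnn /= ltnn mul0r subr0.
Qed.

(** After the column operation the first row is zero beyond its first entry,
since hodd vanishes from index 3 on. *)
Lemma jt_hsuper_cons al mu : (2 <= al)%N ->
  jacobi_trudi hsuper (al :: mu) = hsuper al * jacobi_trudi hodd mu.
Proof.
move=> al2; rewrite jt_hsuper_op.
rewrite (@det_row0 _ (size mu) (jtmx_op (al :: mu))) => [|j]; last first.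
  by rewrite mxE /= addnS subn0; case: al al2 => [|[|al]].
rewrite mxE /= addn0 subn0; congr (_ * \det _).
apply/matrixP => i j; rewrite !mxE !lift0 /= addnS ltnS.
by rewrite subSS.
Qed.

(** After the column operation only the corner entry, equal to x - e, differs
from the determinant in hodd, where it is - e. *)
Lemma jt_hsuper_ones g : jacobi_trudi hsuper (nseq g.+1 1%N) =
  jacobi_trudi hodd (nseq g.+1 1%N) + x * jacobi_trudi hodd (nseq g 1%N).
Proof.
rewrite jt_hsuper_op /=.
rewrite (@det_row0_eq _ _ (jtmx_op (1%N :: nseq g 1%N)) (jtmx hodd (1%N :: nseq g 1%N))).
- rewrite (jtmx_minor hodd 1 (nseq g 1%N)) !mxE /=; congr (_ + _ * _).
  by ring.
- apply/matrixP => i j; rewrite !mxE lift0 /=.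
  have -> : nth 0%N (nseq g 1%N) i = 1%N.
    by rewrite nth_nseq -[X in (_ < X)%N](size_nseq g 1%N) ltn_ord.
  by case: j => -[|j] ltj.
- by move=> j; rewrite !mxE.
Qed.

(** The matrix is tridiagonal, with - e on the diagonal, q above and 1
below. *)
Lemma jt_hodd_ones g : jacobi_trudi hodd (nseq g.+2 1%N) =
  - e * jacobi_trudi hodd (nseq g.+1 1%N) - q * jacobi_trudi hodd (nseq g 1%N).
Proof.
rewrite {1}/jacobi_trudi -/(jtmx hodd (nseq g.+2 1%N)) /=.
rewrite (@expand_det_row _ (size (nseq g 1%N)).+2 (jtmx hodd [:: 1%N, 1%N & nseq g 1%N]) 0).
rewrite !big_ord_recl big1 => [|j _]; last first.
  by rewrite mxE /= mul0r.
rewrite addr0 !mxE /=; congr (_ + _).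
  rewrite /cofactor expr0 mul1r; congr (_ * \det _).
  exact: (jtmx_minor hodd 1 (nseq g.+1 1%N)).
rewrite /cofactor /= expr1 mulN1r mulrN; congr (- (_ * _)).
rewrite det_col0 => [|i]; last first.
  rewrite !mxE /= add0n.
  rewrite nth_nseq -[X in (_ < X)%N](size_nseq g 1%N) ltn_ord.
  by rewrite /bump.
rewrite !mxE /= /bump /= mul1r; congr (\det _).
apply/matrixP => i j; rewrite !mxE /= /bump /= !add1n !add0n.
by rewrite addnS ltnS addnS ltnS !subSS.
Qed.

Lemma jt_hodd_nil : jacobi_trudi hodd [::] = 1.
Proof. exact: det_mx00. Qed.

Lemma jt_hodd1 : jacobi_trudi hodd [:: 1%N] = - e.
Proof. by rewrite /jacobi_trudi det_mx11 mxE. Qed.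

End Specialized.

Section PowerSums.
Variables (R : comAlgType rat) (x y z : R).

Definition signed_psum k : R := x ^+ k - y ^+ k - z ^+ k.

Lemma complete_exp n : complete (fun k => x ^+ k) n = x ^+ n.
Proof.
elim: n => [|n IH]; first by rewrite complete0.
have := complete_sub (fun k => x ^+ k) x n.+1.
rewrite (@eq_complete _ _ (fun=> 0)) => [|k _]; last by rewrite subrr.
by rewrite complete_zero /= IH -exprS => /esym/subr0_eq.
Qed.

Lemma complete_signed_psum n : complete signed_psum n = hsuper x (y + z) (y * z) n.
Proof.
rewrite (@complete_sub _ (fun k => x ^+ k - y ^+ k) z).
case: n => [|[|[|n]]] /=; rewrite ?(complete_sub (fun k => x ^+ k)) /= ?complete_exp ?complete0.
- by ring.
- by ring.
- by ring.
elim: n => [|n IH] /=; rewrite ?(complete_sub (fun k => x ^+ k)) /= ?complete_exp; first by ring.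
move: IH; rewrite ?(complete_sub (fun k => x ^+ k)) /= ?complete_exp => <-.
by rewrite !exprS; ring.
Qed.
End PowerSums.

Lemma hsuper_closed (R : comNzRingType) (x y z : R) n :
  hsuper x (y + z) (y * z) n.+2 = x ^+ n * (x - y) * (x - z).
Proof.
elim: n => [|n IH]; first by rewrite /=; ring.
by rewrite -[LHS]/(0 + x * hsuper x (y + z) (y * z) n.+2) IH exprS; ring.
Qed.

Lemma jt_hodd_two_ones (R : comNzRingType) (e q : R) k g :
  jacobi_trudi (hodd e q) (nseq k 2%N ++ nseq g 1%N) =
  q ^+ k * jacobi_trudi (hodd e q) (nseq g 1%N).
Proof.
elim: k => [|k IH]; first by rewrite mul1r.
by rewrite /= jt_hodd_cons // IH exprS mulrA.
Qed.

(** A partition with parts at most 2, in the form used by hook_column. *)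
Lemma twos_ones (t : seq nat) : sorted geq t -> 0%N \notin t -> (head 0%N t <= 2)%N ->
  t == nseq (count_mem 2%N t) 2%N ++ nseq (count_mem 1%N t) 1%N.
Proof.
elim: t => //= a t IH at_sorted; rewrite inE negb_or eq_sym => /andP [a0 t0] a2.
have ta : all (geq a) t.
  by apply: order_path_min at_sorted => x y' z' h1 h2; apply: leq_trans h2 h1.
have h2 : (head 0%N t <= 2)%N.
  by case: t ta {IH at_sorted t0} => //= b t /andP [ba _]; apply: leq_trans a2.
have := IH (path_sorted at_sorted) t0 h2.
case: a a0 a2 ta {at_sorted} => [|[|[|a]]] //= _ _ ta.
have -> : count_mem 2%N t = 0%N.
  by apply/count_memPn/negP => /(allP ta).
by rewrite !add0n /= eqseq_cons eqxx.
Qed.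

Lemma jt_hsuper_not_hook_column (R : comNzRingType) (x e q : R) la :
  is_part la -> la != [::] -> ~~ hook_column la ->
  jacobi_trudi (hsuper x e q) la = 0.
Proof.
case: la => // al mu; rewrite /is_part /= inE negb_or => /andP [srt /andP [_ mu0]] _ nhc.
case: mu srt mu0 nhc => [|b mu] //=; rewrite -[path _ b mu]/(sorted geq (b :: mu)).
move=> /andP [ba srt] mu0 nhc.
have b3 : (2 < b)%N.
  by rewrite ltnNge; apply: contra nhc; apply: (@twos_ones (b :: mu)).
rewrite jt_hsuper_cons; last by apply: ltnW; apply: leq_trans b3 ba.
rewrite jt_hodd_cons; last exact: ltnW.
by case: b b3 {ba srt mu0 nhc} => [|[|[|b]]] //; rewrite mul0r mulr0.
Qed.

(** * The hook+column part is determined by degrees *)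

Section Degrees.
Variable M : nat.
Hypothesis M_gt1 : (2 <= M)%N.

(** With these exponents the degree of the image of s_(al, 2^k, 1^g) is
M^2 al + M (k + g) + k, which determines al, k and g once k + g < M. *)
Definition sx : {poly rat} := 'X^(M * M).
Definition sy : {poly rat} := 'X^M.
Definition sz : {poly rat} := 'X.

Local Notation th := (hodd (sy + sz) (sy * sz)).
Local Notation et := (hsuper sx (sy + sz) (sy * sz)).

Lemma size_mulS (p q : {poly rat}) a b :
  size p = a.+1 -> size q = b.+1 -> size (p * q) = (a + b).+1.
Proof.
move=> sp sq; rewrite size_mul ?sp ?sq ?addnS //.
  by rewrite -size_poly_eq0 sp.
by rewrite -size_poly_eq0 sq.
Qed.

Lemma size_expS (p : {poly rat}) a n :
  size p = a.+1 -> size (p ^+ n) = (a * n).+1.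
Proof.
move=> sp; elim: n => [|n IH]; first by rewrite size_poly1 muln0.
by rewrite exprS (size_mulS sp IH) mulnS.
Qed.

Let size_sy : size sy = M.+1. Proof. exact: size_polyXn. Qed.
Let size_sz : size sz = 2. Proof. exact: size_polyX. Qed.
Let size_sx : size sx = (M * M).+1. Proof. exact: size_polyXn. Qed.
Let size_e : size (sy + sz) = M.+1.
Proof. by rewrite size_polyDl size_sy ?size_sz. Qed.
Let size_q : size (sy * sz) = M.+2.
Proof. by rewrite (size_mulS size_sy size_sz) addn1. Qed.
Let ltMM : (M < M * M)%N.
Proof. by rewrite -[X in (X < _)%N]muln1 ltn_pmul2l // (ltn_trans _ M_gt1). Qed.

Lemma size_hodd_ones g :
  size (jacobi_trudi th (nseq g 1%N)) = (M * g).+1.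
Proof.
have [n] := ubnP g; elim: n g => // n IH [|[|g]] ltg.
- by rewrite jt_hodd_nil size_poly1 muln0.
- by rewrite jt_hodd1 size_polyN size_e muln1.
rewrite jt_hodd_ones mulNr.
have s1 := size_mulS size_e (IH g.+1 ltg).
have s2 := size_mulS size_q (IH g (ltnW ltg)).
rewrite size_polyDl ?size_polyN ?s1; first by rewrite [in RHS]mulnS.
by rewrite s2; nia.
Qed.

Lemma size_hsuper n : size (et n) = (M * M * n).+1.
Proof.
case: n => [|[|n]]; first by rewrite size_poly1 muln0.
  by rewrite /= mulr1 addrC size_polyDl ?size_polyN ?size_e ?size_sx ?muln1.
rewrite hsuper_closed.
have s1 : size (sx - sy) = (M * M).+1.
  by rewrite size_polyDl ?size_polyN ?size_sx ?size_sy.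
have s2 : size (sx - sz) = (M * M).+1.
  by rewrite size_polyDl ?size_polyN ?size_sx ?size_sz //; nia.
rewrite (size_mulS (size_mulS (size_expS n size_sx) s1) s2).
by rewrite !mulnS; nia.
Qed.

Lemma size_hsuper_hook_column al k g :
  is_part (al :: nseq k 2%N ++ nseq g 1%N) ->
  size (jacobi_trudi et (al :: nseq k 2%N ++ nseq g 1%N)) =
    (M * M * al + M * (k + g) + k).+1.
Proof.
have [al2 _|] := leqP 2 al.
  rewrite jt_hsuper_cons // jt_hodd_two_ones.
  rewrite (size_mulS (size_hsuper al) (size_mulS (size_expS k size_q) (size_hodd_ones g))).
  by congr (_.+1); nia.
case: al => [|[|//]] _; first by rewrite /is_part in_cons eqxx andbF.
case: k => [|k] ps; last by move: ps; rewrite /is_part /=.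
rewrite [nseq 0 _ ++ _]/= -[1%N :: _]/(nseq g.+1 1%N) jt_hsuper_ones.
have s1 := size_mulS size_sx (size_hodd_ones g).
rewrite addrC size_polyDl s1; first by congr (_.+1); nia.
by rewrite size_hodd_ones; nia.
Qed.
End Degrees.

(** The coefficient at the top degree of a largest polynomial that occurs comes
from this polynomial only. *)
Lemma size_independent (I : eqType) (s : seq I) (P : pred I) (D : I -> rat)
    (f : I -> {poly rat}) :
  uniq s -> (forall i, i \in s -> ~~ P i -> f i = 0) ->
  (forall i, i \in s -> P i -> f i != 0) ->
  {in s & s, forall i j, P i -> P j -> size (f i) = size (f j) -> i = j} ->
  \sum_(i <- s) D i *: f i = 0 -> forall i, i \in s -> P i -> D i = 0.
Proof.
move=> us f0 fn0 finj sum0 i0 i0s Pi0; apply/eqP; apply: contraT => Di0.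
pose T d := has (fun i => [&& P i, D i != 0 & size (f i) == d]) s.
have exT : exists d, T d.
  by exists (size (f i0)); apply/hasP; exists i0; rewrite // Pi0 Di0 eqxx.
have ubT d : T d -> (d <= \sum_(i <- s) size (f i))%N.
  by case/hasP => i si /and3P [_ _ /eqP <-]; rewrite (big_rem _ si) leq_addr.
case: (ex_maxnP exT ubT) => d /hasP [i si /and3P [Pi Di /eqP sf]] d_max.
have := congr1 (fun p : {poly rat} => p`_d.-1) sum0.
rewrite coef0 (bigD1_seq i) //= coefD coefZ coef_sum big_seq_cond big1.
  rewrite addr0 -sf -[_`_ _]/(lead_coef (f i)) => /eqP.
  by rewrite mulf_eq0 (negPf Di) lead_coef_eq0 (negPf (fn0 i si Pi)).
move=> j /andP [js ji]; rewrite coefZ.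
have [->|Dj] := eqVneq (D j) 0; first by rewrite mul0r.
have [Pj|nPj] := boolP (P j); last by rewrite (f0 j js nPj) coef0 mulr0.
have lej : (size (f j) <= d)%N.
  by apply: d_max; apply/hasP; exists j; rewrite // Pj Dj eqxx.
rewrite nth_default ?mulr0 // -ltnS prednK; last first.
  by rewrite -sf lt0n size_poly_eq0 fn0.
rewrite ltn_neqAle lej andbT; apply: contra ji => /eqP sj.
by apply/eqP/finj => //; rewrite sj sf.
Qed.

Lemma ev_schur_signed (R : comAlgType rat) (x y z : R) la :
  ev (signed_psum x y z) (schur la) = jacobi_trudi (hsuper x (y + z) (y * z)) la.
Proof.
rewrite ev_schur /jacobi_trudi; congr (\det _); apply/matrixP => i j.
by rewrite !mxE complete_signed_psum.
Qed.

(** The partitions whose Schur functions have a nonzero image. *)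
Definition nil_or_hook_column la := (la == [::]) || hook_column la.

(** For la = (al, 2^k, 1^g) the size of la is k + g + 1; the empty partition
gets degree 0. *)
Definition hc_degree M (la : seq nat) :=
  (M * M * head 0%N la + M * (size la).-1 + count_mem 2%N (behead la))%N.

Lemma size_ev_schur M la : (2 <= M)%N -> is_part la -> nil_or_hook_column la ->
  size (ev (signed_psum (sx M) (sy M) sz) (schur la)) = (hc_degree M la).+1.
Proof.
move=> M_gt1 pla; rewrite ev_schur_signed /nil_or_hook_column; case/predU1P => [->|].
  by rewrite /jacobi_trudi det_mx00 size_poly1 /hc_degree /= !muln0.
move=> /hook_columnP [al [k [g Ela]]]; move: pla; rewrite Ela => pla.
rewrite (size_hsuper_hook_column M_gt1 pla) /hc_degree /=.
rewrite size_cat !size_nseq count_cat !count_nseq /= mul1n mul0n addn0.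
by [].
Qed.

Lemma hc_degree_inj M la mu : (size la < M)%N -> (size mu < M)%N ->
  is_part la -> is_part mu -> nil_or_hook_column la -> nil_or_hook_column mu ->
  hc_degree M la = hc_degree M mu -> la = mu.
Proof.
move=> lM mM pl pm vl vm.
have M0 : (0 < M)%N by exact: leq_ltn_trans lM.
have cl (nu : seq nat) : (size nu < M)%N ->
   (count_mem 2%N (behead nu) < M)%N /\ ((size nu).-1 < M)%N.
  case: nu => [|b nu] /= ltM; first by split.
  by split; [apply: leq_ltn_trans (count_size _ _) _|]; apply: ltnW.
have [c1 s1] := cl _ lM; have [c2 s2] := cl _ mM.
rewrite /hc_degree => E.
have Ec : count_mem 2%N (behead la) = count_mem 2%N (behead mu).
  have := congr1 (modn^~ M) E.
  by rewrite /= -!mulnA -!mulnDr ![(M * _)%N]mulnC !modnMDl !modn_small.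
have Es : (size la).-1 = (size mu).-1.
  move: E; rewrite Ec => /addIn /(congr1 (divn^~ M)) /=.
  rewrite -!mulnA -!mulnDr ![(M * (_ + _))%N]mulnC !mulnK // => /(congr1 (modn^~ M)).
  by rewrite /= ![(M * _)%N]mulnC !modnMDl !modn_small.
have Eh : head 0%N la = head 0%N mu.
  move: E; rewrite Ec Es => /addIn /addIn /eqP.
  by rewrite eqn_pmul2l ?muln_gt0 ?M0 // => /eqP.
move: vl vm Ec Es Eh pl pm; rewrite /nil_or_hook_column.
case: la {lM mM c1 c2 s1 s2 cl E} => [|b la]; case: mu => [|c mu] //=.
- by move=> _ _ _ _ <-; rewrite /is_part in_cons eqxx andbF.
- by move=> _ _ _ _ ->; rewrite /is_part in_cons eqxx andbF.
move=> /eqP El /eqP Em Ec Es -> _ _; congr (_ :: _).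
rewrite El Em -Ec; congr (_ ++ nseq _ _).
move: Es; rewrite {1}El {1}Em -Ec !size_cat !size_nseq.
by move/addnI.
Qed.

Lemma sum_regroup (V : lmodType rat) (s : seq (rat * seq nat)) (A : seq (seq nat))
    (G : seq nat -> V) : uniq A -> {subset [seq p.2 | p <- s] <= A} ->
  \sum_(p <- s) p.1 *: G p.2 =
  \sum_(la <- A) (\sum_(p <- s | p.2 == la) p.1) *: G la.
Proof.
move=> uA sA; under [RHS]eq_bigr do rewrite scaler_suml big_mkcond.
rewrite exchange_big [LHS]big_seq [RHS]big_seq /=; apply: eq_bigr => p ps.
rewrite (bigD1_seq p.2) //= ?eqxx; last by apply/sA/map_f.
rewrite big1 ?addr0 // => la; rewrite eq_sym => /negPf ->.
by [].
Qed.

Definition hc_only (V : lmodType rat) (S : seq nat -> V) la :=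
  if hook_column la then S la else 0.

Lemma sum_hc_only (V : lmodType rat) (S : seq nat -> V) (T : Type) (r : seq T)
    (c : T -> rat) (v : T -> seq nat) :
  \sum_(i <- r | hook_column (v i)) c i *: S (v i) =
  \sum_(p <- [seq (c i, v i) | i <- r]) p.1 *: hc_only S p.2.
Proof.
rewrite big_map big_mkcond; apply: eq_bigr => i _.
by rewrite /hc_only /=; case: ifP => // _; rewrite scaler0.
Qed.

Lemma hc_only_all (V : lmodType rat) (S : seq nat -> V) (s : seq (rat * seq nat)) :
  (forall p, p \in s -> hook_column p.2) ->
  \sum_(p <- s) p.1 *: hc_only S p.2 = \sum_(p <- s) p.1 *: S p.2.
Proof.
move=> s_hc; rewrite [LHS]big_seq [RHS]big_seq; apply: eq_bigr => p /s_hc h.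
by rewrite /hc_only h.
Qed.

Lemma eq_hc_only (V : lmodType rat) (S : seq nat -> V) (A : seq (seq nat))
    (c d : seq nat -> rat) :
  (forall la, la \in A -> hook_column la -> c la = d la) ->
  \sum_(la <- A) c la *: hc_only S la = \sum_(la <- A) d la *: hc_only S la.
Proof.
move=> cd; rewrite [LHS]big_seq [RHS]big_seq; apply: eq_bigr => la lA.
by rewrite /hc_only; case: ifP => [h|_]; rewrite ?scaler0 // cd.
Qed.

(** A Schur expansion of f and the proposed one differ by a combination with
zero image; its coefficients at hook+column partitions vanish by independence,
once M exceeds the lengths of all partitions involved. *)
Lemma hc_part_eq f (s : seq (rat * seq nat)) :
  (forall p, p \in s -> is_part p.2 && hook_column p.2) ->
  (forall M, (2 <= M)%N ->
    ev (signed_psum (sx M) (sy M) sz) f =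
    \sum_(p <- s) p.1 *: ev (signed_psum (sx M) (sy M) sz) (schur p.2)) ->
  hc_part f = \sum_(p <- s) p.1 *: schur p.2.
Proof.
move=> s_hc ev_f; pose a := schur_coef f.
pose sa := [seq (a la, val la) | la <- finsupp a].
pose A := undup ([seq p.2 | p <- sa] ++ [seq p.2 | p <- s]).
have uA : uniq A by exact: undup_uniq.
have saA : {subset [seq p.2 | p <- sa] <= A}.
  by move=> la; rewrite mem_undup mem_cat => ->.
have sA : {subset [seq p.2 | p <- s] <= A}.
  by move=> la; rewrite mem_undup mem_cat orbC => ->.
have pA la : la \in A -> is_part la.
  rewrite mem_undup mem_cat => /orP [] /mapP [p ps ->].
    by case/mapP: ps => mu _ ->; exact: valP.
  by case/andP: (s_hc p ps).
have fE : f = \sum_(p <- sa) p.1 *: schur p.2.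
  by rewrite big_map -[LHS]schur_coefK.
pose M := (\sum_(la <- A) size la).+2.
have sM la : la \in A -> (size la < M)%N.
  by move=> lA; rewrite ltnS /M (big_rem _ lA) /= leqW // leq_addr.
pose phi := fun la => ev (signed_psum (sx M) (sy M) sz) (schur la).
pose cf (t : seq (rat * seq nat)) la := \sum_(p <- t | p.2 == la) p.1.
have D0 : \sum_(la <- A) (cf sa la - cf s la) *: phi la = 0.
  under eq_bigr do rewrite scalerBl.
  rewrite sumrB -!sum_regroup // -(ev_f M) //; apply/eqP; rewrite subr_eq0; apply/eqP.
  rewrite [in RHS]fE raddf_sum /=.
  by apply: eq_bigr => p _; rewrite evZ.
have cfE la : la \in A -> hook_column la -> cf sa la = cf s la.
  move=> lA hl; apply/subr0_eq.
  refine (@size_independent _ A nil_or_hook_column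
    (fun la => cf sa la - cf s la) phi uA _ _ _ D0 la lA _).
  - move=> mu mA; rewrite /nil_or_hook_column negb_or => /andP [mu0 nh].
    by rewrite /phi ev_schur_signed jt_hsuper_not_hook_column // pA.
  - by move=> mu mA vm; rewrite -size_poly_eq0 size_ev_schur // pA.
  - move=> mu nu mA nA vm vn; rewrite !size_ev_schur ?pA // => -[].
    by apply: hc_degree_inj; rewrite ?sM ?pA.
  - by rewrite /nil_or_hook_column hl orbT.
transitivity (\sum_(p <- sa) p.1 *: hc_only schur p.2).
  exact: (sum_hc_only schur).
transitivity (\sum_(p <- s) p.1 *: hc_only schur p.2); last first.
  by apply: hc_only_all => p /s_hc /andP [].
rewrite (sum_regroup _ uA saA) (sum_regroup _ uA sA).
exact: eq_hc_only.
Qed.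

(** * The polynomials of multiplicities *)

Definition quarter_sq n := (n ^ 2 %/ 4)%N.

Lemma quarter_sqS2 n : quarter_sq n.+2 = (quarter_sq n + n.+1)%N.
Proof.
rewrite /quarter_sq (_ : n.+2 ^ 2 = n.+1 * 4 + n ^ 2)%N; last by rewrite -!mulnn; nia.
by rewrite divnMDl // addnC.
Qed.

Lemma leq_quarter_sq m n : (m <= n)%N -> (quarter_sq m <= quarter_sq n)%N.
Proof. by move=> le_mn; rewrite leq_div2r // leq_exp2r. Qed.

Lemma quarter_sq_min m n :
  minn (quarter_sq m) (quarter_sq n) = quarter_sq (minn m n).
Proof.
case: (leqP m n) => [|/ltnW] h; first by rewrite (minn_idPl (leq_quarter_sq h)).
by rewrite (minn_idPr (leq_quarter_sq h)).
Qed.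

(** The coefficient of q^j in h_m(1, q, q, q^2); it vanishes for j > 2 m. *)
Definition bcoef m j := quarter_sq (minn j.+2 (2 * m + 2 - j)).

Definition bpoly m : {poly rat} := \poly_(j < (2 * m).+1) (bcoef m j)%:R.

Lemma coef_bpoly m j : (bpoly m)`_j = (bcoef m j)%:R.
Proof.
rewrite coef_poly; case: ltnP => // lt_j; rewrite /bcoef.
have : (2 * m + 2 - j <= 1)%N by lia.
by case: (2 * m + 2 - j)%N => [|[|n]] // _; rewrite ?minn0 // (minn_idPr _).
Qed.

Lemma bcoef_low m j : (j <= m)%N -> bcoef m j = quarter_sq j.+2.
Proof. by move=> h; rewrite /bcoef; congr quarter_sq; lia. Qed.

Lemma bcoef_high m j : (m <= j)%N -> bcoef m j = quarter_sq (2 * m + 2 - j).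
Proof. by move=> h; rewrite /bcoef; congr quarter_sq; lia. Qed.

Lemma coef_Xsq (p : {poly rat}) j : ('X ^+ 2 * p)`_j = if (j < 2)%N then 0 else p`_(j - 2).
Proof. exact: coefXnM. Qed.

(** The generating function 1 / ((1 - t) (1 - t q)^2 (1 - t q^2)) times
(1 - t) (1 - t q^2) is 1 / (1 - t q)^2. *)
Lemma bpoly_rec m :
  bpoly m - (1 + 'X ^+ 2) * shift bpoly m + 'X ^+ 2 * shift (shift bpoly) m =
  m.+1%:R *: 'X ^+ m.
Proof.
case: m => [|[|m]] /=.
- rewrite !mulr0 subr0 addr0; apply/polyP => j; rewrite coef_bpoly coefZ coefXn.
  by case: j => [|[|j]]; rewrite ?mulr1 ?mulr0 // /bcoef /= subn_eq0.
- rewrite mulr0 addr0; apply/polyP => j.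
  rewrite coefB mulrDl mul1r coefD coef_Xsq !coef_bpoly coefZ coefXn.
  by case: j => [|[|[|[|j]]]].
apply/polyP => j.
rewrite coefD coefB mulrDl mul1r coefD !coef_Xsq !coef_bpoly coefZ coefXn.
have [lt_j|gt_j|->] := ltngtP j m.+2.
- rewrite mulr0; case: ltnP => j2.
    by rewrite !bcoef_low ?subn0; [ring|lia..].
  by rewrite !bcoef_low; [ring|lia..].
- have j2 : (j < 2)%N = false by lia.
  rewrite mulr0 j2.
  rewrite !bcoef_high; try lia.
  rewrite (_ : 2 * m.+2 + 2 - j = 2 * m.+1 + 2 - (j - 2))%N; last by lia.
  rewrite (_ : 2 * m.+1 + 2 - j = 2 * m + 2 - (j - 2))%N; last by lia.
  ring.
- rewrite mulr1 /= subSS subSS subn0 (bcoef_low (leqnn m.+2)).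
  rewrite (bcoef_low (leqnSn m)) (bcoef_low (leqnn m)).
  rewrite bcoef_high // (_ : 2 * m.+1 + 2 - m.+2 = m.+2)%N; last by lia.
  by rewrite quarter_sqS2 natrD; ring.
Qed.

(** The multiplicity of s_(2ac-2k, 2^k). *)
Definition acoef c k :=
  minn ((k ^ 2 + k + 2) %/ 2) (((2 * c - 1 - k) ^ 2 + (2 * c - 1 - k) + 2) %/ 2).

Definition apoly c : {poly rat} := \poly_(k < 2 * c) (acoef c k)%:R.

Lemma tri_quarter n :
  ((n ^ 2 + n + 2) %/ 2 = quarter_sq n.+2 + quarter_sq n.-1)%N.
Proof.
case: n => [|n] //=; elim: n => [|n IH] //.
have -> : (n.+2 ^ 2 + n.+2 + 2 = (n.+1 ^ 2 + n.+1 + 2) + n.+2 * 2)%N by rewrite -!mulnn; nia.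
rewrite divnDMl // IH !quarter_sqS2.
by case: n {IH} => [|n] //=; rewrite ?quarter_sqS2; lia.
Qed.

Lemma acoefE c k :
  acoef c k = (quarter_sq (minn k (2 * c - 1 - k)).+2 +
               quarter_sq (minn k (2 * c - 1 - k)).-1)%N.
Proof.
rewrite /acoef !tri_quarter; move: (2 * c - 1 - k)%N => l.
by case: (leqP k l) => [h|/ltnW h]; [apply/minn_idPl|apply/minn_idPr];
  apply: leq_add; apply: leq_quarter_sq; lia.
Qed.

Lemma coef_Xn_bpoly t m k :
  ('X ^+ t * bpoly m)`_k = (quarter_sq (minn (k + 2 - t) (2 * m + 2 + t - k)))%:R.
Proof.
rewrite coefXnM coef_bpoly /bcoef; case: ltnP => h; last first.
  by congr ((quarter_sq _)%:R); lia.
have : (minn (k + 2 - t) (2 * m + 2 + t - k) <= 1)%N by lia.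
by case: minn => [|[|n]].
Qed.

Lemma coef_Xn_shift_bpoly t d k : (1 < t)%N ->
  ('X ^+ t * shift bpoly d)`_k = (quarter_sq (minn (k + 2 - t) (2 * d + t - k)))%:R.
Proof.
case: d => [|d] t2; last by rewrite coef_Xn_bpoly; congr ((quarter_sq (minn _ _))%:R); lia.
rewrite mulr0 coef0.
have : (minn (k + 2 - t) (2 * 0 + t - k) <= 1)%N by lia.
by case: minn => [|[|n]].
Qed.

(** For k < 2c the coefficients of q^k on both sides are
quarter_sq (l + 2) + quarter_sq (l - 1) with l = min (k, 2c - 1 - k) and
truncated subtraction, as the remaining values of quarter_sq cancel. *)
Lemma apolyE d :
  apoly d.+2 = (1 + 'X) * (bpoly d.+1 - 'X * bpoly d + 'X ^+ 2 * shift bpoly d).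
Proof.
rewrite [RHS](_ : _ = 'X ^+ 0 * bpoly d.+1 + 'X ^+ 1 * bpoly d.+1
  - 'X ^+ 1 * bpoly d - 'X ^+ 2 * bpoly d
  + 'X ^+ 2 * shift bpoly d + 'X ^+ 3 * shift bpoly d); last by ring.
apply/polyP => k; rewrite !(coefD, coefN) !coef_Xn_bpoly !coef_Xn_shift_bpoly //.
rewrite coef_poly acoefE natrD.
have [lt_k|le_k] := ltnP k d.+2.
  rewrite ifT; last by lia.
  rewrite !(minn_idPl _); try lia.
  rewrite (_ : k + 2 - 3 = k.-1)%N; last by lia.
  rewrite (_ : k + 2 - 0 = k.+2)%N; last by lia.
  by ring.
rewrite !(minn_idPr _); try lia.
set l := (2 * d.+2 - 1 - k)%N.
case: ltnP => lt_k.
  rewrite (_ : 2 * d.+1 + 2 + 0 - k = l.+1)%N; last by rewrite /l; lia.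
  rewrite (_ : 2 * d.+1 + 2 + 1 - k = l.+2)%N; last by rewrite /l; lia.
  rewrite (_ : 2 * d + 2 + 1 - k = l)%N; last by rewrite /l; lia.
  rewrite (_ : 2 * d + 2 + 2 - k = l.+1)%N; last by rewrite /l; lia.
  rewrite (_ : 2 * d + 2 - k = l.-1)%N; last by rewrite /l; lia.
  rewrite (_ : 2 * d + 3 - k = l)%N; last by rewrite /l; lia.
  by ring.
have small n : (n <= 1)%N -> quarter_sq n = 0%N by case: n => [|[|n]].
by rewrite !small; [ring|lia..].
Qed.

(** Homogenization in degree n, evaluated at (u, q). *)
Section Homogeneous.
Variables (R : comAlgType rat) (u q : R).

Definition homog n (p : {poly rat}) : R :=
  \sum_(i < n.+1) p`_i *: (u ^+ (n - i) * q ^+ i).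

Lemma homD n p p' : homog n (p + p') = homog n p + homog n p'.
Proof. by rewrite -big_split; apply: eq_bigr => i _; rewrite coefD scalerDl. Qed.

Lemma homN n p : homog n (- p) = - homog n p.
Proof. by rewrite -sumrN; apply: eq_bigr => i _; rewrite coefN scaleNr. Qed.

Lemma hom0 n : homog n 0 = 0.
Proof. by apply: big1 => i _; rewrite coef0 scale0r. Qed.

Lemma homS n (p : {poly rat}) : (size p <= n.+1)%N -> homog n.+1 p = u * homog n p.
Proof.
move=> sp; rewrite /homog big_ord_recr /= nth_default // scale0r addr0 mulr_sumr.
apply: eq_bigr => i _; rewrite -scalerAr mulrA -exprS subSn //.
by rewrite -ltnS.
Qed.

Lemma homX n (p : {poly rat}) : homog n.+1 ('X * p) = q * homog n p.
Proof.
rewrite /homog big_ord_recl coefXM scale0r add0r mulr_sumr.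
apply: eq_bigr => i _; rewrite lift0 coefXM /= subSS -scalerAr exprS.
by congr (_ *: _); ring.
Qed.

Lemma homXn n m c : (m <= n)%N ->
  homog n (c *: 'X ^+ m) = c *: (u ^+ (n - m) * q ^+ m).
Proof.
move=> le_mn; have lt_m : (m < n.+1)%N by [].
rewrite /homog (bigD1 (Ordinal lt_m)) //= coefZ coefXn eqxx mulr1 big1 ?addr0 //.
move=> i im; rewrite coefZ coefXn (_ : (_ == m) = false) ?mulr0 ?scale0r //.
by apply: contraNF im => /eqP im; apply/eqP/val_inj.
Qed.

Lemma size_bpoly m : (size (bpoly m) <= (2 * m).+1)%N.
Proof. exact: size_poly. Qed.

(** h_m(u^2, u q, u q, q^2). *)
Definition bhomog m := homog (2 * m) (bpoly m).

Lemma bhomog_rec m :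
  bhomog m - (u ^+ 2 + q ^+ 2) * shift bhomog m + (u * q) ^+ 2 * shift (shift bhomog) m =
  m.+1%:R * (u * q) ^+ m.
Proof.
have hX2 n p : homog n.+2 ('X ^+ 2 * p) = q ^+ 2 * homog n p.
  by rewrite (_ : 'X ^+ 2 * p = 'X * ('X * p)) ?homX //; ring.
have hS2 n : homog (2 * n).+2 (bpoly n) = u ^+ 2 * bhomog n.
  by rewrite /bhomog !homS ?(leqW (size_bpoly _)) ?size_bpoly //; ring.
have := congr1 (homog (2 * m)) (bpoly_rec m).
rewrite homXn; last by lia.
rewrite (_ : 2 * m - m = m)%N; last by lia.
rewrite scaler_nat => E; rewrite [RHS]mulr_natl [X in X *+ _]exprMn -{}E.
rewrite [(1 + _) * _]mulrDl mul1r !homD homN homD.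
case: m => [|[|m]] /=; rewrite ?mulr0 ?hom0 //.
  by rewrite /bhomog; ring.
  have -> : homog (2 * 1) (bpoly 0) = u ^+ 2 * bhomog 0 by exact: (hS2 0%N).
  have -> : homog (2 * 1) ('X ^+ 2 * bpoly 0) = q ^+ 2 * bhomog 0 by exact: (hX2 0%N).
  by rewrite -/(bhomog 1); ring.
have E2 : (2 * m.+2 = (2 * m.+1).+2)%N by lia.
have E1 : (2 * m.+1 = (2 * m).+2)%N by lia.
rewrite [in homog _ (bpoly m.+1)]E2 hS2 [X in homog X ('X ^+ 2 * bpoly m.+1)]E2 hX2.
rewrite -/(bhomog m.+1) [X in homog X ('X ^+ 2 * bpoly m)]E2 hX2 E1 hS2 -/(bhomog m.+2).
by ring.
Qed.

Lemma hom_apoly d : homog (2 * d.+1).+1 (apoly d.+2) =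
  (u + q) * (bhomog d.+1 - u * q * bhomog d + (u * q) ^+ 2 * shift bhomog d).
Proof.
have hX1 n (p : {poly rat}) : (size p <= n.+1)%N ->
    homog n.+1 ((1 + 'X) * p) = (u + q) * homog n p.
  by move=> sp; rewrite mulrDl mul1r homD homX homS // mulrDl.
have E : (2 * d.+1 = (2 * d).+2)%N by lia.
have hXb : homog (2 * d.+1) ('X * bpoly d) = u * q * bhomog d.
  by rewrite E homX homS ?size_bpoly // /bhomog; ring.
have hX2b : homog (2 * d.+1) ('X ^+ 2 * shift bpoly d) = (u * q) ^+ 2 * shift bhomog d.
  case: (d) => [|d'] /=; first by rewrite !mulr0 hom0.
  rewrite (_ : 'X ^+ 2 * bpoly d' = 'X * ('X * bpoly d')); last by ring.
  rewrite (_ : 2 * d'.+2 = (2 * d').+4)%N; last by lia.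
  by rewrite !homX !homS ?(leqW (size_bpoly _)) ?size_bpoly // /bhomog; ring.
rewrite apolyE hX1 ?homD ?homN ?hXb ?hX2b //.
rewrite (leq_trans (size_polyD _ _)) // geq_max (leq_trans (size_polyD _ _)) /=.
  rewrite (leq_trans (size_polyMleq _ _)) // size_polyXn /=.
  case: (d) => [|d'] /=; first by rewrite size_poly0; lia.
  by apply: leq_trans (leq_add (leqnn 2) (size_bpoly d')) _; lia.
rewrite geq_max size_bpoly size_polyN (leq_trans (size_polyMleq _ _)) // size_polyX /=.
by apply: leq_trans (size_bpoly d) _; lia.
Qed.
End Homogeneous.

(** * The alphabet of h_2 o h_a *)

Section SignedAlphabets.
Variable R : comAlgType rat.
Implicit Types (P : nat -> R) (w : R).

Definition padd P w : nat -> R := fun k => P k + w ^+ k.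
Definition psub P w : nat -> R := fun k => P k - w ^+ k.

Lemma complete_psub P w n : complete (psub P w) n = complete P n - w * shift (complete P) n.
Proof. exact: complete_sub. Qed.

Lemma complete_padd P w n :
  complete (padd P w) n - w * shift (complete (padd P w)) n = complete P n.
Proof.
rewrite -complete_psub; apply: eq_complete => k _.
by rewrite /psub /padd addrK.
Qed.

Lemma complete_padd_unique P w (u : nat -> R) :
  (forall n, u n - w * shift u n = complete P n) -> forall n, complete (padd P w) n = u n.
Proof.
move=> uP; elim=> [|n IH].
  by have := uP 0%N; rewrite complete0 /= mulr0 subr0 complete0.
have := uP n.+1; rewrite -(complete_padd P w) /= IH => /(congr1 (fun a => a + w * u n)).
by rewrite !subrK.
Qed.

Lemma complete_double w n :
  complete (padd (padd (fun=> 0) w) w) n = n.+1%:R * w ^+ n.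
Proof.
apply: (@complete_padd_unique _ _ (fun n => n.+1%:R * w ^+ n)) => {}n.
rewrite (@complete_padd_unique _ _ (fun n => w ^+ n)) => [|{}n].
  case: n => [|n] /=; first by ring.
  by rewrite exprS -[n.+2%:R]natr1; ring.
case: n => [|n]; first by rewrite complete0 /=; ring.
by rewrite complete_zero /= exprS subrr.
Qed.
End SignedAlphabets.

(** For x = 1 and s = 1 the letters below are 1, q, q, q^2 with sign + and
y, z, q y, q z with sign -; s stands for x^(2a-4). *)
Section SchurOfSchur.
Variables (R : comAlgType rat) (x y z s : R).

Let q := y * z.
Let w1 := s * (x * x * (x * x)).
Let w2 := s * (x * x * q).
Let w4 := s * (q * q).
Definition h2h_even := padd (padd (padd (padd (fun=> 0) w2) w2) w1) w4.
Definition h2h_alphabet := psub (psub (psub (psub h2h_even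
  (s * (x * x * x * y))) (s * (x * x * x * z))) (s * (x * q * y))) (s * (x * q * z)).

Lemma complete_h2h_even m : complete h2h_even m = s ^+ m * bhomog (x * x) q m.
Proof.
pose k m := s ^+ m * bhomog (x * x) q m; rewrite -[RHS]/(k m).
apply: complete_padd_unique => {}m.
pose v n := k n - w4 * shift k n; rewrite -[LHS]/(v m); apply/esym.
apply: complete_padd_unique => {}m; rewrite complete_double.
have sE n : shift k n.+1 = s ^+ n * bhomog (x * x) q n by [].
have E := bhomog_rec (x * x) q m.
rewrite /w2 exprMn mulrCA -E {E}.
case: m => [|[|m]]; rewrite /v /= ?sE /k /w1 /w4 ?exprS; ring.
Qed.

(** The recurrence of the generating function 1 / D, with (1 - w2 t)^2 moved to
the other side. *)
Lemma complete_h2h_even_rec m :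
  complete h2h_even m = m.+1%:R * w2 ^+ m + (w1 + w4) * shift (complete h2h_even) m
    - w1 * w4 * shift (shift (complete h2h_even)) m.
Proof.
have shE n : shift (complete h2h_even) n = shift (fun m => s ^+ m * bhomog (x * x) q m) n.
  by case: n => //= n; rewrite complete_h2h_even.
have ssE n : shift (shift (complete h2h_even)) n = shift (shift (fun m => s ^+ m * bhomog (x * x) q m)) n.
  by case: n => //= n; rewrite shE.
rewrite shE ssE complete_h2h_even.
have E := bhomog_rec (x * x) q m.
rewrite /w2 exprMn mulrCA -E {E}.
by case: m => [|[|m]] /=; rewrite /w1 /w4 ?exprS; ring.
Qed.

(** The quotient of generating functions is a combination of the h_m of the
even letters; eliminating the highest one by the recurrence makes the factor
(x - y) (x - z) appear. The recurrence has order 4, so the first three cases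
are separate. *)
Lemma complete_h2h c : complete h2h_alphabet c.+1 = (x - y) * (x - z) *
  (s * (x * x + q) * (complete h2h_even c - w2 * shift (complete h2h_even) c
                      + w2 ^+ 2 * shift (shift (complete h2h_even)) c)
   - s ^+ 2 * x ^+ 3 * (y + z) * q * shift (complete h2h_even) c).
Proof.
have E1 : complete h2h_even 1 = 2%:R * w2 + (w1 + w4).
  by rewrite complete_h2h_even_rec /= complete0; ring.
have E2 : complete h2h_even 2 = 3%:R * w2 ^+ 2 + (w1 + w4) * complete h2h_even 1 - w1 * w4.
  by rewrite complete_h2h_even_rec /= complete0; ring.
have E3 : complete h2h_even 3 = 4%:R * w2 ^+ 3 + (w1 + w4) * complete h2h_even 2 - w1 * w4 * complete h2h_even 1.
  by rewrite complete_h2h_even_rec /=.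
have E4 n : complete h2h_even n.+4 = (w1 + w4) * complete h2h_even n.+3 - w1 * w4 * complete h2h_even n.+2
  + 2%:R * w2 * (complete h2h_even n.+3 - (w1 + w4) * complete h2h_even n.+2 + w1 * w4 * complete h2h_even n.+1)
  - w2 ^+ 2 * (complete h2h_even n.+2 - (w1 + w4) * complete h2h_even n.+1 + w1 * w4 * complete h2h_even n).
  have G m : m.+3%:R * w2 ^+ m.+2 =
    complete h2h_even m.+2 - (w1 + w4) * complete h2h_even m.+1 + w1 * w4 * complete h2h_even m.
    by rewrite (complete_h2h_even_rec m.+2) /=; ring.
  rewrite (complete_h2h_even_rec n.+4) /= -!G.
  by rewrite !exprS -[n.+4.+1%:R]natr1 -[n.+4%:R]natr1; ring.
rewrite /h2h_alphabet.
case: c => [|[|[|n]]]; rewrite !complete_psub /= !complete_psub /= ?complete_psub /= ?complete_psub /=.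
- by rewrite E1 complete0 /w1 /w2 /w4 /q; ring.
- by rewrite E2 E1 complete0 /w1 /w2 /w4 /q; ring.
- by rewrite E3 E2 E1 complete0 /w1 /w2 /w4 /q; ring.
- by rewrite E4 /w1 /w2 /w4 /q; ring.
Qed.

Lemma complete_h2h_hom d : complete h2h_alphabet d.+2 = (x - y) * (x - z) * s ^+ d.+2 *
  (homog (x * x) q (2 * d.+1).+1 (apoly d.+2) - x ^+ 3 * (y + z) * q * bhomog (x * x) q d).
Proof.
rewrite complete_h2h hom_apoly /= !complete_h2h_even /w2.
by case: d => [|d] /=; rewrite ?complete_h2h_even ?exprS; ring.
Qed.
End SchurOfSchur.

Lemma ev_hsym_signed (R : comAlgType rat) (x y z : R) b :
  ev (signed_psum x y z) (hsym b.+2) = x ^+ b * (x - y) * (x - z).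
Proof. by rewrite -/(complete _ _) complete_signed_psum hsuper_closed. Qed.

Lemma signed_psum_mul (R : comAlgType rat) (x y z : R) n k :
  signed_psum x y z (n * k) = signed_psum (x ^+ n) (y ^+ n) (z ^+ n) k.
Proof. by rewrite /signed_psum !exprM. Qed.

(** 2 h_2 = p_1^2 + p_2. *)
Lemma ev_h2h (R : comAlgType rat) (x y z : R) b :
  ev (signed_psum x y z) (plethysm (hsym 2) (hsym b.+2)) =
  h2h_alphabet x y z (x ^+ (2 * b)) 1.
Proof.
rewrite ev_plethysm -/(complete _ _); set P := fun n => _.
have PE n : P n = x ^+ n ^+ b * (x ^+ n - y ^+ n) * (x ^+ n - z ^+ n).
  rewrite /P (eq_ev (Q := signed_psum (x ^+ n) (y ^+ n) (z ^+ n))).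
    by rewrite ev_hsym_signed.
  by move=> k _; exact: signed_psum_mul.
apply: (@mulSn_inj _ 1); rewrite /= complete_newton !big_ord_recr big_ord0 /= add0r.
have -> : complete P 1 = P 1%N.
  by apply: (@mulSn_inj _ 0); rewrite /= complete_newton big_ord_recr big_ord0 /= complete0; ring.
rewrite subnn complete0 !PE /h2h_alphabet /h2h_even /psub /padd !expr1 exprM ![x ^+ 2 ^+ b]exprAC.
by move: (x ^+ b) => t; ring.
Qed.

(** The letters are monomials, so raising the variables to the power n gives
the n-th power sum. *)
Lemma h2h_alphabet_exp (R : comAlgType rat) (x y z s : R) n :
  h2h_alphabet (x ^+ n) (y ^+ n) (z ^+ n) (s ^+ n) 1 = h2h_alphabet x y z s n.
Proof.
by rewrite /h2h_alphabet /h2h_even /psub /padd !expr1 !exprMn.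
Qed.

Lemma ev_h_h2_h (R : comAlgType rat) (x y z : R) b d :
  ev (signed_psum x y z) (plethysm (hsym d.+2) (plethysm (hsym 2) (hsym b.+2))) =
  (x - y) * (x - z) * (x ^+ (2 * b)) ^+ d.+2 *
  (homog (x * x) (y * z) (2 * d.+1).+1 (apoly d.+2)
     - x ^+ 3 * (y + z) * (y * z) * bhomog (x * x) (y * z) d).
Proof.
rewrite ev_plethysm -/(complete _ _) -complete_h2h_hom; apply: eq_complete => n _.
rewrite (eq_ev (Q := signed_psum (x ^+ n) (y ^+ n) (z ^+ n))) => [|k _]; last exact: signed_psum_mul.
by rewrite ev_h2h exprAC h2h_alphabet_exp.
Qed.

(** * The iterated plethysm *)

Lemma ev_schur_twos (R : comAlgType rat) (x y z : R) n k :
  ev (signed_psum x y z) (schur (n.+2 :: nseq k 2%N)) =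
  x ^+ n * (x - y) * (x - z) * (y * z) ^+ k.
Proof.
rewrite ev_schur_signed jt_hsuper_cons // hsuper_closed -[nseq k 2%N]cats0.
by rewrite (jt_hodd_two_ones _ _ k 0) jt_hodd_nil mulr1.
Qed.

Lemma ev_schur_twos1 (R : comAlgType rat) (x y z : R) n k :
  ev (signed_psum x y z) (schur (n.+2 :: nseq k 2%N ++ [:: 1%N])) =
  - (x ^+ n * (x - y) * (x - z) * (y + z) * (y * z) ^+ k).
Proof.
rewrite ev_schur_signed jt_hsuper_cons // hsuper_closed.
by rewrite (jt_hodd_two_ones _ _ k 1) jt_hodd1; ring.
Qed.

Lemma is_part_twos n k : is_part (n.+2 :: nseq k 2%N).
Proof.
rewrite /is_part in_cons mem_nseq andbF andbT /=.
by elim: k n => //= k IH n; rewrite (IH 0%N).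
Qed.

Lemma is_part_twos1 n k : is_part (n.+2 :: nseq k 2%N ++ [:: 1%N]).
Proof.
rewrite /is_part in_cons mem_cat mem_nseq andbF andbT /=.
by elim: k n => //= k IH n; rewrite (IH 0%N).
Qed.

Lemma sum_twos_homog (R : comAlgType rat) (x y z : R) b d :
  \sum_(0 <= k < (2 * d.+2 - 1).+1)
    (acoef d.+2 k)%:R *:
      ev (signed_psum x y z) (schur ((2 * b.+2 * d.+2 - 2 * k)%N :: nseq k 2%N)) =
  (x - y) * (x - z) * (x ^+ (2 * b)) ^+ d.+2 *
  homog (x * x) (y * z) (2 * d.+1).+1 (apoly d.+2).
Proof.
rewrite (_ : (2 * d.+2 - 1).+1 = (2 * d.+1).+2)%N; last by lia.
rewrite big_mkord /homog mulr_sumr; apply: eq_bigr => i _.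
have lti := ltn_ord i.
rewrite (_ : (2 * b.+2 * d.+2 - 2 * i)%N =
             (2 * b * d.+2 + 2 * ((2 * d.+1).+1 - i)).+2); last by nia.
rewrite ev_schur_twos -scalerAr coef_poly ifT; last by lia.
congr (_ *: _); rewrite exprD !exprM -[x * x]/(x ^+ 2).
by ring.
Qed.

Lemma sum_twos1_homog (R : comAlgType rat) (x y z : R) b d :
  \sum_(1 <= k < (2 * d.+2 - 3).+1)
    (minn ((k + 1) ^ 2 %/ 4) ((2 * d.+2 - 1 - k) ^ 2 %/ 4))%N%:R *:
      ev (signed_psum x y z) (schur ((2 * b.+2 * d.+2 - 2 * k - 1)%N :: nseq k 2%N ++ [:: 1%N])) =
  - ((x - y) * (x - z) * (x ^+ (2 * b)) ^+ d.+2 *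
  (x ^+ 3 * (y + z) * (y * z) * bhomog (x * x) (y * z) d)).
Proof.
rewrite (_ : (2 * d.+2 - 3).+1 = (2 * d).+1.+1)%N; last by lia.
rewrite big_add1 [_.+2.-1]/= big_mkord /bhomog /homog 2!mulr_sumr -sumrN; apply: eq_bigr => i _.
have lti := ltn_ord i.
rewrite (_ : (2 * b.+2 * d.+2 - 2 * i.+1 - 1)%N =
             (2 * b * d.+2 + 3 + 2 * (2 * d - i)).+2); last by nia.
rewrite ev_schur_twos1 coef_bpoly -!scalerAr -scalerN.
congr (_%:R *: _).
  rewrite /bcoef -quarter_sq_min /quarter_sq addn1.
  by congr (minn _ (_ ^ 2 %/ 4)); lia.
rewrite [x ^+ (_ + _ + _)]exprD [x ^+ (_ + 3)]exprD !exprM -[x * x]/(x ^+ 2).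
rewrite [(y * z) ^+ _.+1]exprS.
by ring.
Qed.

(* k^2 + k + 2 is always even, so the divisions by 2 are exact. *)
Theorem mainTheorem2 (a c : nat) (ha : (2 <= a)%N) (hc : (2 <= c)%N) :
  hc_part (plethysm (schur [:: c]) (plethysm (schur [:: 2%N]) (schur [:: a]))) =
    \sum_(0 <= k < (2 * c - 1).+1)
      (minn ((k ^ 2 + k + 2) %/ 2)
            (((2 * c - 1 - k) ^ 2 + (2 * c - 1 - k) + 2) %/ 2))%N%:R
        *: schur ((2 * a * c - 2 * k)%N :: nseq k 2%N)
  + \sum_(1 <= k < (2 * c - 3).+1)
      (minn ((k + 1) ^ 2 %/ 4) ((2 * c - 1 - k) ^ 2 %/ 4))%N%:R
        *: schur ((2 * a * c - 2 * k - 1)%N :: nseq k 2%N ++ [:: 1%N]).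
Proof.
pose s1 := [seq ((acoef c k)%:R : rat, (2 * a * c - 2 * k)%N :: nseq k 2%N)
           | k <- index_iota 0 (2 * c - 1).+1].
pose s2 := [seq ((minn ((k + 1) ^ 2 %/ 4) ((2 * c - 1 - k) ^ 2 %/ 4))%N%:R : rat,
                 (2 * a * c - 2 * k - 1)%N :: nseq k 2%N ++ [:: 1%N])
           | k <- index_iota 1 (2 * c - 3).+1].
have sumE (V : lmodType rat) (F : seq nat -> V) : \sum_(p <- s1 ++ s2) p.1 *: F p.2 =
    \sum_(0 <= k < (2 * c - 1).+1)
      (acoef c k)%:R *: F ((2 * a * c - 2 * k)%N :: nseq k 2%N)
  + \sum_(1 <= k < (2 * c - 3).+1)
      (minn ((k + 1) ^ 2 %/ 4) ((2 * c - 1 - k) ^ 2 %/ 4))%N%:R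
        *: F ((2 * a * c - 2 * k - 1)%N :: nseq k 2%N ++ [:: 1%N]).
  by rewrite big_cat !big_map.
rewrite -[RHS](sumE _ schur); apply: hc_part_eq => [p|M _].
  rewrite mem_cat => /orP [] /mapP [k]; rewrite mem_index_iota;
    move=> /andP [k1 k2] ->; rewrite [(_, _).2]/=.
    rewrite (_ : (2 * a * c - 2 * k)%N = (2 * a * c - 2 * k - 2).+2); last by nia.
    rewrite is_part_twos andTb; apply/hook_columnP.
    by exists (2 * a * c - 2 * k - 2).+2, k, 0%N; rewrite cats0.
  rewrite (_ : (2 * a * c - 2 * k - 1)%N = (2 * a * c - 2 * k - 3).+2); last by nia.
  rewrite is_part_twos1 andTb; apply/hook_columnP.
  by exists (2 * a * c - 2 * k - 3).+2, k, 1%N.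
rewrite (sumE _ (fun la => ev (signed_psum (sx M) (sy M) sz) (schur la))).
case: a ha {s1 s2 sumE} => [|[|b]] // _; case: c hc => [|[|d]] // _.
by rewrite !schur_row ev_h_h2_h sum_twos_homog sum_twos1_homog mulrBr.
Qed.
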